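(* Assume $M<0$, $N\ge3$ and $p\ge\frac{N+2}{N-2}$. Then there exist ground states $u$ of (E). Moreover they satisfy $u(r)\sim U_M(r)$ as $r\to\infty$.
   Context: (E) denotes the ODE $-u_{rr}-\frac{N-1}{r}u_r=|u|^{p-1}u+M|u_r|^{\frac{2p}{p+1}}$ for $r>0$. A ground state is a nonnegative $u\in C^2([0,\infty))$ with $u_r(0)=0$ solving (E) on $(0,\infty)$. With $K=\frac{(N-2)p-N}{p-1}$, for $N\ge3$, $p\ge\frac{N}{N-2}$, $M<0$ the equation $X^{p-1}+M\left(\frac{2}{p-1}\right)^{\frac{2p}{p+1}}X^{\frac{p-1}{p+1}}-\frac{2K}{p-1}=0$ has a unique positive root $X_M$, and $U_M(r)=X_Mr^{-\frac{2}{p-1}}$. $f\sim g$ means $f/g\to1$. *)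

(* Defs.v *)
From Stdlib Require Import Reals.
From Coquelicot Require Import Coquelicot.
Open Scope R_scope.

(* Real power with the convention 0^a = 0 (used only with a > 0 or x > 0). *)
Definition rpow (x a : R) : R := if Rlt_dec 0 x then Rpower x a else 0.

Definition C2_nonneg (u du ddu : R -> R) : Prop :=
  (forall r, 0 < r -> is_derive u r (du r)) /\
  (forall r, 0 < r -> is_derive du r (ddu r)) /\
  (forall r, 0 < r -> continuous ddu r) /\
  filterlim (fun h => (u h - u 0) / h) (at_right 0) (locally (du 0)) /\
  filterlim (fun h => (du h - du 0) / h) (at_right 0) (locally (ddu 0)) /\
  filterlim ddu (at_right 0) (locally (ddu 0)).

Definition eqE (N : nat) (p M : R) (u du ddu : R -> R) (r : R) : Prop :=
  - ddu r - (INR N - 1) / r * du r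
  = rpow (Rabs (u r)) (p - 1) * u r + M * rpow (Rabs (du r)) (2 * p / (p + 1)).

Definition ground_state (N : nat) (p M : R) (u : R -> R) : Prop :=
  exists du ddu : R -> R,
    C2_nonneg u du ddu /\
    (forall r, 0 <= r -> 0 <= u r) /\
    du 0 = 0 /\
    (forall r, 0 < r -> eqE N p M u du ddu r).

Definition Kexp (N : nat) (p : R) : R := ((INR N - 2) * p - INR N) / (p - 1).

Definition is_XM (N : nat) (p M X : R) : Prop :=
  0 < X /\
  rpow X (p - 1) + M * rpow (2 / (p - 1)) (2 * p / (p + 1)) * rpow X ((p - 1) / (p + 1))
    - 2 * Kexp N p / (p - 1) = 0.

Definition U_M (p X r : R) : R := X * rpow r (- (2 / (p - 1))).

(* Main.v *)
Require Import Defs.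
From Stdlib Require Import Reals.
From Stdlib Require Import Lra Lia Classical.
From Coquelicot Require Import Coquelicot.
Open Scope R_scope.

(* With alpha = 2/(p-1), q = 2p/(p+1), m = -M, t = ln r, the scaled quantities X = r^alpha u and
   Y = - r^(alpha+1) u' solve the autonomous system
     X' = alpha X - Y,   Y' = - K Y + X^p - m Y^q,
   where alpha <= K because p is at least the Sobolev exponent.  For V' = X^p - alpha K X - m (alpha X)^q, the energy
   E = X'^2/2 + V(X) decreases:
     E' = - (K - alpha) X'^2 - m X' ((alpha X)^q - (alpha X - X')^q) <= - m |X'|^(q+1).
   A regular solution leaves the origin with E = 0, so E < 0 afterwards; as E >= 0 where X = 0, u cannot vanish.
   Negative energy also keeps X bounded and away from 0, and dissipation forces X' -> 0 and hence X -> X_M, the only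
   positive zero of V'.  Existence is a global Picard iteration for v = - u' with a truncated right-hand side. *)

(** * Real powers and one-variable calculus *)

(** At the critical exponent [alpha = K], so the linear damping is zero and only the difference of
    the two [q]-th powers dissipates energy. Its sign rests on [M < 0] and its size on
    superadditivity of [x^q] for nonnegative arguments, which requires [Y >= 0], that is [u' <= 0].
    Monotonicity of [u] therefore has to be secured before any energy argument: by a separate
    differential inequality for an arbitrary ground state, by the integral equation for the
    constructed profile.

    The origin sits at [t = - infinity], so only limits of [X] and [E] are available there. If
    [E >= 0] at some time, the energy is 0 at all earlier times, [X] is constant there, and its
    limit makes it 0. This single implication serves twice: it excludes a zero of the constructed
    profile, and it makes the energy of a nontrivial ground state negative.

    The right-hand side is truncated because the powers are only locally Lipschitz, while a
    contraction on the whole half-line needs a global constant. *)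

Lemma rpow_pos (x a : R) : 0 < x -> rpow x a = Rpower x a.
Proof. intros h; unfold rpow; destruct (Rlt_dec 0 x); [reflexivity | lra]. Qed.

Lemma rpow_nonpos (x a : R) : x <= 0 -> rpow x a = 0.
Proof. intros h; unfold rpow; destruct (Rlt_dec 0 x); [lra | reflexivity]. Qed.

Lemma rpow_gt0 (x a : R) : 0 < x -> 0 < rpow x a.
Proof. intros h; rewrite rpow_pos by exact h; apply exp_pos. Qed.

Lemma rpow_ge0 (x a : R) : 0 <= rpow x a.
Proof.
  destruct (Rlt_dec 0 x) as [h | h].
  - left; now apply rpow_gt0.
  - rewrite rpow_nonpos; lra.
Qed.

Lemma rpow_1_l (a : R) : rpow 1 a = 1.
Proof. rewrite rpow_pos by lra; unfold Rpower; now rewrite ln_1, Rmult_0_r, exp_0. Qed.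

Lemma rpow_plus (x a b : R) : rpow x (a + b) = rpow x a * rpow x b.
Proof.
  destruct (Rlt_dec 0 x) as [h | h].
  - rewrite !rpow_pos by exact h; apply Rpower_plus.
  - rewrite !rpow_nonpos by lra; ring.
Qed.

Lemma rpow_succ (x a : R) : 0 <= x -> rpow x (a + 1) = rpow x a * x.
Proof.
  intros h; destruct (Rlt_dec 0 x) as [h' | h'].
  - rewrite !rpow_pos by exact h'; now rewrite Rpower_plus, Rpower_1.
  - rewrite !rpow_nonpos by lra; ring.
Qed.

Lemma rpow_scal (c x a : R) : 0 < c -> rpow (c * x) a = rpow c a * rpow x a.
Proof.
  intros hc; destruct (Rlt_dec 0 x) as [h | h].
  - assert (0 < c * x) by now apply Rmult_lt_0_compat.
    rewrite !rpow_pos by assumption; symmetry; now apply Rpower_mult_distr.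
  - rewrite (rpow_nonpos x), (rpow_nonpos (c * x)) by nra; ring.
Qed.

Lemma rpow_le (x y a : R) : 0 <= a -> x <= y -> rpow x a <= rpow y a.
Proof.
  intros ha h; destruct (Rlt_dec 0 x) as [hx | hx].
  - rewrite !rpow_pos by lra; apply Rle_Rpower_l; lra.
  - rewrite (rpow_nonpos x) by lra; apply rpow_ge0.
Qed.

Lemma rpow_lt (x y a : R) : 0 < a -> 0 < y -> x < y -> rpow x a < rpow y a.
Proof.
  intros ha hy h; destruct (Rlt_dec 0 x) as [hx | hx].
  - rewrite !rpow_pos by lra; now apply Rlt_Rpower_l.
  - rewrite (rpow_nonpos x) by lra; now apply rpow_gt0.
Qed.

Lemma rpow_inv_lt (x y a : R) : 0 < a -> 0 < y -> x < rpow y (/ a) -> rpow x a < y.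
Proof.
  intros ha hy h.
  assert (hp := rpow_gt0 y (/ a) hy).
  apply Rlt_le_trans with (rpow (rpow y (/ a)) a); [now apply rpow_lt |].
  rewrite (rpow_pos (rpow _ _)), (rpow_pos y) by assumption.
  rewrite Rpower_mult, Rinv_l, Rpower_1; lra.
Qed.

Lemma continuous_rpow (a x : R) : 0 < a -> continuous (fun x => rpow x a) x.
Proof.
  intros ha; destruct (Rtotal_order x 0) as [h | [h | h]].
  - apply continuous_ext_loc with (fun _ => 0); [| apply continuous_const].
    exists (mkposreal (- x) ltac:(lra)); intros y hy.
    rewrite rpow_nonpos; [reflexivity |].
    apply Rabs_lt_between' in hy; simpl in hy; lra.
  - subst x; apply filterlim_locally; intros eps.
    exists (mkposreal _ (rpow_gt0 eps (/ a) (cond_pos eps))); intros y hy.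
    apply Rabs_lt_between' in hy; simpl in hy.
    rewrite (rpow_nonpos 0) by lra.
    apply Rabs_lt_between'.
    assert (rpow y a < eps) by (apply rpow_inv_lt; [lra | apply cond_pos | lra]).
    assert (h0 := rpow_ge0 y a); assert (he := cond_pos eps); lra.
  - apply continuous_ext_loc with (fun y => Rpower y a).
    + exists (mkposreal x h); intros y hy.
      apply Rabs_lt_between' in hy; simpl in hy.
      rewrite rpow_pos; [reflexivity | lra].
    + apply (ex_derive_continuous (fun y => Rpower y a)); exists (a * Rpower x (a - 1)).
      apply is_derive_Reals; now apply derivable_pt_lim_power.
Qed.

(** At 0 the difference quotient is [y^(a-1)] on the right and 0 on the left, and [1 < a] sends it
    to 0. *)
Lemma is_derive_rpow (a x : R) :
  1 < a -> is_derive (fun x => rpow x a) x (a * rpow x (a - 1)).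
Proof.
  intros ha; destruct (Rtotal_order x 0) as [h | [h | h]].
  - rewrite rpow_nonpos, Rmult_0_r by lra.
    apply is_derive_ext_loc with (fun _ => 0); [| apply @is_derive_const].
    exists (mkposreal (- x) ltac:(lra)); intros y hy.
    rewrite rpow_nonpos; [reflexivity |].
    apply Rabs_lt_between' in hy; simpl in hy; lra.
  - subst x; rewrite rpow_nonpos, Rmult_0_r by lra.
    apply is_derive_Reals; intros eps heps.
    exists (mkposreal _ (rpow_gt0 eps (/ (a - 1)) heps)); intros y hy hy'; simpl in hy'.
    rewrite Rplus_0_l, (rpow_nonpos 0) by lra.
    destruct (Rlt_dec 0 y) as [h | h].
    + replace ((rpow y a - 0) / y - 0) with (rpow y (a - 1)).
      * rewrite Rabs_pos_eq by apply rpow_ge0.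
        apply rpow_inv_lt; [lra | exact heps |].
        rewrite Rabs_pos_eq in hy'; lra.
      * replace a with ((a - 1) + 1) at 2 by ring.
        rewrite rpow_succ by lra; field; lra.
    + rewrite rpow_nonpos by lra.
      replace ((0 - 0) / y - 0) with 0 by (field; lra).
      now rewrite Rabs_R0.
  - apply is_derive_ext_loc with (fun y => Rpower y a).
    + exists (mkposreal x h); intros y hy.
      apply Rabs_lt_between' in hy; simpl in hy.
      rewrite rpow_pos; [reflexivity | lra].
    + rewrite rpow_pos by exact h.
      apply is_derive_Reals; now apply derivable_pt_lim_power.
Qed.

Lemma mean_value (f df : R -> R) (a b : R) :
  a <= b -> (forall x, a <= x <= b -> is_derive f x (df x)) ->
  exists c, a <= c <= b /\ f b - f a = df c * (b - a).
Proof.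
  intros hab hd.
  destruct (MVT_gen f a b df) as [c hc].
  - rewrite Rmin_left, Rmax_right by exact hab; intros x hx; apply hd; lra.
  - rewrite Rmin_left, Rmax_right by exact hab; intros x hx.
    apply continuity_pt_filterlim, (ex_derive_continuous f); exists (df x); now apply hd.
  - rewrite Rmin_left, Rmax_right in hc by exact hab; now exists c.
Qed.

Lemma nonincreasing_of_derive (f df : R -> R) (a b : R) :
  a <= b -> (forall x, a <= x <= b -> is_derive f x (df x)) ->
  (forall x, a <= x <= b -> df x <= 0) -> f b <= f a.
Proof.
  intros hab hd hn.
  destruct (mean_value f df a b hab hd) as [c [hc he]].
  specialize (hn c hc); nra.
Qed.

Lemma nondecreasing_of_derive (f df : R -> R) (a b : R) :
  a <= b -> (forall x, a <= x <= b -> is_derive f x (df x)) ->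
  (forall x, a <= x <= b -> 0 <= df x) -> f a <= f b.
Proof.
  intros hab hd hn.
  destruct (mean_value f df a b hab hd) as [c [hc he]].
  specialize (hn c hc); nra.
Qed.

(** Applied to the energy, which is bounded below: after time [T] less than [eta] can still be lost.
    The infimum is minus the supremum of [- f]. *)
Lemma near_infimum (f : R -> R) (t0 C eta : R) :
  (forall t, t0 <= t -> C <= f t) -> 0 < eta ->
  exists T, t0 <= T /\ forall t, t0 <= t -> f T - eta < f t.
Proof.
  intros hC heta.
  destruct (completeness (fun y => exists t, t0 <= t /\ y = - f t)) as [s [hs1 hs2]].
  - exists (- C); intros y [t [ht ->]]; specialize (hC t ht); lra.
  - exists (- f t0), t0; split; [lra | reflexivity].
  - destruct (classic (exists T, t0 <= T /\ s - eta < - f T)) as [[T [hT h]] | hn].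
    + exists T; split; [exact hT |]; intros t ht.
      assert (- f t <= s) by (apply hs1; now exists t); lra.
    + exfalso; assert (s <= s - eta); [| lra].
      apply hs2; intros y [t [ht ->]]; apply Rnot_lt_le; intros h; apply hn; now exists t.
Qed.

Lemma variation_bound (f df : R -> R) (a b D : R) : a <= b ->
  (forall x, a <= x <= b -> is_derive f x (df x)) ->
  (forall x, a <= x <= b -> Rabs (df x) <= D) -> Rabs (f b - f a) <= D * (b - a).
Proof.
  intros hab hd hD.
  destruct (mean_value f df a b hab hd) as [c [hc ->]].
  rewrite Rabs_mult, (Rabs_pos_eq (b - a)) by lra.
  apply Rmult_le_compat_r; [lra | auto].
Qed.

(** The point is the supremum of the set where [f <= c]. Barrier arguments use it: an inequality
    valid only above the level [c] holds on the whole stretch beyond [s], and the value at [s] is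
    exactly [c]. *)
Lemma last_crossing (f : R -> R) (a b c : R) :
  a <= b -> (forall x, a <= x <= b -> continuous f x) -> f a <= c < f b ->
  exists s, a <= s < b /\ f s = c /\ forall x, s < x <= b -> c < f x.
Proof.
  intros hab hf [ha hb].
  destruct (completeness (fun x => a <= x <= b /\ f x <= c)) as [s [hs1 hs2]].
  - exists b; intros x [hx _]; lra.
  - exists a; split; [lra | exact ha].
  - assert (has : a <= s) by (apply hs1; split; [lra | exact ha]).
    assert (hsb : s <= b) by (apply hs2; intros x [hx _]; lra).
    assert (hafter : forall x, s < x <= b -> c < f x).
    { intros x hx; apply Rnot_le_lt; intros hle.
      assert (x <= s) by (apply hs1; split; lra); lra. }
    assert (hcont := proj1 (filterlim_locally _ _) (hf s (conj has hsb))).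
    assert (hle : f s <= c).
    { apply Rnot_lt_le; intros hlt.
      destruct (hcont (mkposreal (f s - c) ltac:(lra))) as [del hdel].
      assert (hd := cond_pos del).
      assert (s <= s - del); [| lra].
      apply hs2; intros x [hx hxc]; apply Rnot_lt_le; intros hxs.
      assert (x <= s) by (apply hs1; split; assumption).
      assert (h := hdel x ltac:(apply Rabs_lt_between'; lra)).
      apply Rabs_lt_between' in h; simpl in h; lra. }
    assert (hne : s <> b) by (intros ->; lra).
    exists s; split; [lra | split; [| exact hafter]].
    apply Rle_antisym; [exact hle |]; apply Rnot_lt_le; intros hlt.
    destruct (hcont (mkposreal (c - f s) ltac:(lra))) as [del hdel].
    assert (hd := cond_pos del).
    set (x := Rmin b (s + del / 2)).
    assert (hx1 : s < x) by (apply Rmin_glb_lt; lra).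
    assert (hx2 : x <= b) by apply Rmin_l.
    assert (hx3 : x <= s + del / 2) by apply Rmin_r.
    assert (h := hdel x ltac:(apply Rabs_lt_between'; lra)).
    apply Rabs_lt_between' in h; simpl in h.
    specialize (hafter x (conj hx1 hx2)); lra.
Qed.

Lemma rpow_lipschitz (a B x y : R) :
  1 < a -> x <= y <= B ->
  0 <= rpow y a - rpow x a <= a * rpow B (a - 1) * (y - x).
Proof.
  intros ha [h1 h2]; split; [assert (h := rpow_le x y a); lra |].
  destruct (mean_value (fun x => rpow x a) (fun x => a * rpow x (a - 1)) x y) as [c [hc he]].
  - exact h1.
  - intros z _; now apply is_derive_rpow.
  - rewrite he; apply Rmult_le_compat_r; [lra |].
    apply Rmult_le_compat_l; [lra |]; apply rpow_le; lra.
Qed.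

(** As a function of [y], the difference [y^a - (y - x)^a] is nondecreasing because its derivative
    compares the powers of [y] and [y - x]; at [y = x] it equals [x^a]. *)
Lemma rpow_superadditive (a x y : R) :
  1 < a -> 0 <= x <= y -> rpow (y - x) a <= rpow y a - rpow x a.
Proof.
  intros ha [hx hy].
  assert (h : rpow x a - rpow (x - x) a <= rpow y a - rpow (y - x) a).
  { apply (nondecreasing_of_derive (fun y => rpow y a - rpow (y - x) a)
      (fun y => a * rpow y (a - 1) - a * rpow (y - x) (a - 1))).
    - exact hy.
    - intros z _; apply @is_derive_minus; [now apply is_derive_rpow |].
      replace (a * rpow (z - x) (a - 1)) with (scal 1 (a * rpow (z - x) (a - 1)))
        by apply Rmult_1_l.
      apply (is_derive_comp (fun x => rpow x a) (fun y => y - x)).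
      + now apply is_derive_rpow.
      + auto_derive; [trivial | ring].
    - intros z hz.
      assert (rpow (z - x) (a - 1) <= rpow z (a - 1)) by (apply rpow_le; lra).
      nra. }
  rewrite Rminus_diag, (rpow_nonpos 0) in h by lra; lra.
Qed.

Lemma filterlim_Rmult {T} (F : (T -> Prop) -> Prop) {FF : Filter F} (f g : T -> R) (a b : R) :
  filterlim f F (locally a) -> filterlim g F (locally b) ->
  filterlim (fun x => f x * g x) F (locally (a * b)).
Proof. intros hf hg; exact (filterlim_comp_2 f g Rmult hf hg (@filterlim_mult R_AbsRing a b)). Qed.

Lemma filterlim_Rplus {T} (F : (T -> Prop) -> Prop) {FF : Filter F} (f g : T -> R) (a b : R) :
  filterlim f F (locally a) -> filterlim g F (locally b) ->
  filterlim (fun x => f x + g x) F (locally (a + b)).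
Proof.
  intros hf hg.
  exact (filterlim_comp_2 f g Rplus hf hg (@filterlim_plus R_AbsRing R_NormedModule a b)).
Qed.

Lemma rpow_exp (x a : R) : rpow (exp x) a = exp (a * x).
Proof. rewrite rpow_pos by apply exp_pos; unfold Rpower; now rewrite ln_exp. Qed.

Lemma right_continuous_of_right_derivative (f : R -> R) (l : R) :
  filterlim (fun h => (f h - f 0) / h) (at_right 0) (locally l) ->
  filterlim f (at_right 0) (locally (f 0)).
Proof.
  intros hf.
  apply filterlim_within_ext with (fun h => (f h - f 0) / h * h + f 0).
  - intros h hh; field; lra.
  - replace (locally (f 0)) with (locally (l * 0 + f 0)) by (f_equal; ring).
    apply (filterlim_Rplus (at_right 0)); [| apply filterlim_const].
    apply (filterlim_Rmult (at_right 0)); [exact hf |].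
    intros P hP; now apply filter_le_within.
Qed.

Lemma right_quotient_of_derive (f : R -> R) (l : R) :
  is_derive f 0 l -> filterlim (fun h => (f h - f 0) / h) (at_right 0) (locally l).
Proof.
  intros hf; apply is_derive_Reals in hf; apply filterlim_locally; intros eps.
  destruct (hf eps (cond_pos eps)) as [del hdel].
  exists del; intros h hh hpos.
  change (Rabs (h - 0) < del) in hh; rewrite Rminus_0_r in hh.
  specialize (hdel h ltac:(lra) hh); rewrite Rplus_0_l in hdel; exact hdel.
Qed.

(** * The Lyapunov function of the autonomous system *)

Section Lyapunov.

Variables (al K m p q : R).
Hypotheses (al_gt0 : 0 < al) (K_ge_al : al <= K) (m_gt0 : 0 < m)
  (q_gt1 : 1 < q) (q_lt_p : q < p).

Definition force (x : R) : R := rpow x p - al * K * x - m * rpow al q * rpow x q.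

Definition potential (x : R) : R :=
  rpow x (p + 1) / (p + 1) - al * K * x ^ 2 / 2 - m * rpow al q * (rpow x (q + 1) / (q + 1)).

Definition energy (x y : R) : R := (al * x - y) ^ 2 / 2 + potential x.

(** The signs are part of the notion because the dissipation estimate compares [q]-th powers of
    nonnegative numbers. *)
Definition solves (X Y : R -> R) (t : R) : Prop :=
  is_derive X t (al * X t - Y t) /\
  is_derive Y t (- K * Y t + rpow (X t) p - m * rpow (Y t) q) /\
  0 <= X t /\ 0 <= Y t.

Lemma is_derive_potential (x : R) : is_derive potential x (force x).
Proof.
  assert (hp := is_derive_rpow (p + 1) x ltac:(lra)).
  assert (hq := is_derive_rpow (q + 1) x ltac:(lra)).
  replace (p + 1 - 1) with p in hp by ring.
  replace (q + 1 - 1) with q in hq by ring.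
  unfold potential; set (f := fun x => rpow x (p + 1)) in *; set (g := fun x => rpow x (q + 1)) in *.
  change (is_derive (fun x => f x / (p + 1) - al * K * x ^ 2 / 2 - m * rpow al q * (g x / (q + 1)))
    x (force x)).
  auto_derive.
  - split; [now exists ((p + 1) * rpow x p) | split; [now exists ((q + 1) * rpow x q) | trivial]].
  - replace (Derive (fun x => f x) x) with ((p + 1) * rpow x p) by (symmetry; now apply is_derive_unique).
    replace (Derive (fun x => g x) x) with ((q + 1) * rpow x q) by (symmetry; now apply is_derive_unique).
    unfold force; field; lra.
Qed.

(** Adding and subtracting [m (al X)^q] places the gradient term at rest into the force; everything
    besides the force then vanishes with the velocity. *)
Lemma is_derive_velocity (X Y : R -> R) (t : R) : solves X Y t ->
  is_derive (fun t => al * X t - Y t) t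
    ((al - K) * (al * X t - Y t) + m * (rpow (Y t) q - rpow (al * X t) q) - force (X t)).
Proof.
  intros [hX [hY [hx hy]]].
  auto_derive.
  - split; [now eexists; apply hX | split; [now eexists; apply hY | trivial]].
  - replace (Derive (fun x => X x) t) with (al * X t - Y t) by (symmetry; now apply is_derive_unique).
    replace (Derive (fun x => Y x) t) with (- K * Y t + rpow (X t) p - m * rpow (Y t) q)
      by (symmetry; now apply is_derive_unique).
    rewrite rpow_scal by exact al_gt0; unfold force; ring.
Qed.

Definition dissipation (x y : R) : R :=
  (al - K) * (al * x - y) ^ 2 - m * (al * x - y) * (rpow (al * x) q - rpow y q).

Lemma is_derive_energy (X Y : R -> R) (t : R) : solves X Y t ->
  is_derive (fun t => energy (X t) (Y t)) t (dissipation (X t) (Y t)).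
Proof.
  intros hs; assert (hZ := is_derive_velocity X Y t hs); destruct hs as [hX [hY [hx hy]]].
  assert (hV : is_derive (fun t => potential (X t)) t ((al * X t - Y t) * force (X t))).
  { apply (is_derive_comp potential X); [apply is_derive_potential | exact hX]. }
  unfold energy.
  set (Z := fun t => al * X t - Y t) in *.
  set (W := fun t => potential (X t)) in *.
  change (is_derive (fun t => Z t ^ 2 / 2 + W t) t (dissipation (X t) (Y t))).
  auto_derive.
  - split; [eexists; apply hZ | split; [eexists; apply hV | trivial]].
  - replace (Derive (fun x => Z x) t) with ((al - K) * Z t + m * (rpow (Y t) q - rpow (al * X t) q) - force (X t))
      by (symmetry; now apply is_derive_unique).
    replace (Derive (fun x => W x) t) with ((al * X t - Y t) * force (X t))
      by (symmetry; now apply is_derive_unique).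
    unfold dissipation, Z; field.
Qed.

(** The linear damping has the good sign by [al <= K] and is discarded. Superadditivity, applied to
    [al x] and [y] in their order, bounds the remaining product below by [|al x - y|^(q+1)], so the
    estimate holds even when [al = K]. *)
Lemma dissipation_le (x y : R) : 0 <= x -> 0 <= y ->
  dissipation x y <= - m * rpow (Rabs (al * x - y)) (q + 1).
Proof.
  intros hx hy; unfold dissipation.
  set (a := al * x); set (z := a - y).
  assert (ha : 0 <= a) by (unfold a; nra).
  rewrite rpow_succ by apply Rabs_pos.
  enough (hs : Rabs z * rpow (Rabs z) q <= z * (rpow a q - rpow y q)).
  { assert (0 <= (K - al) * z ^ 2) by (apply Rmult_le_pos; [lra | apply pow2_ge_0]).
    nra. }
  destruct (Rle_dec y a) as [h | h].
  - rewrite Rabs_pos_eq by (unfold z; lra).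
    apply Rmult_le_compat_l; [unfold z; lra |].
    apply rpow_superadditive; [lra | split; lra].
  - rewrite Rabs_left by (unfold z; lra).
    replace (z * (rpow a q - rpow y q)) with (- z * (rpow y q - rpow a q)) by ring.
    apply Rmult_le_compat_l; [unfold z; lra |].
    replace (- z) with (y - a) by (unfold z; ring).
    apply rpow_superadditive; [lra | split; lra].
Qed.

Lemma dissipation_nonpos (x y : R) : 0 <= x -> 0 <= y -> dissipation x y <= 0.
Proof.
  intros hx hy; assert (h := dissipation_le x y hx hy).
  assert (h' := rpow_ge0 (Rabs (al * x - y)) (q + 1)); nra.
Qed.

Lemma energy_nonincreasing (X Y : R -> R) (s t : R) :
  s <= t -> (forall r, s <= r <= t -> solves X Y r) ->
  energy (X t) (Y t) <= energy (X s) (Y s).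
Proof.
  intros hst hs.
  apply (nonincreasing_of_derive (fun t => energy (X t) (Y t)) (fun t => dissipation (X t) (Y t)));
    [exact hst | intros; apply is_derive_energy; auto |].
  intros x hx; destruct (hs x hx) as [_ [_ [h1 h2]]]; now apply dissipation_nonpos.
Qed.

(* A trajectory leaving the origin with nonnegative energy would have zero dissipation, hence [X' = 0]. *)
Lemma energy_nonneg_trivial (X Y : R -> R) (T : R) :
  (forall t, t <= T -> solves X Y t) ->
  (forall eps, 0 < eps -> exists A, forall t, t <= A -> energy (X t) (Y t) <= eps) ->
  (forall eps, 0 < eps -> exists A, forall t, t <= A -> X t <= eps) ->
  0 <= energy (X T) (Y T) ->
  forall t, t < T -> X t = 0.
Proof.
  intros hs hE hX hT.
  assert (h0 : forall t, t <= T -> energy (X t) (Y t) = 0).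
  { intros t ht; apply Rle_antisym.
    - apply le_epsilon; intros eps heps.
      destruct (hE eps heps) as [A hA].
      apply Rle_trans with (energy (X (Rmin A t)) (Y (Rmin A t))).
      + apply energy_nonincreasing; [apply Rmin_r |]; intros; apply hs; lra.
      + rewrite Rplus_0_l; apply hA, Rmin_l.
    - apply Rle_trans with (1 := hT).
      apply energy_nonincreasing; [exact ht |]; intros; apply hs; lra. }
  assert (hZ : forall t, t < T -> al * X t - Y t = 0).
  { intros t ht.
    destruct (hs t (Rlt_le _ _ ht)) as [_ [_ [hx hy]]].
    (* The energy is constant near [t], so its derivative, the dissipation, is 0. *)
    assert (hd : dissipation (X t) (Y t) = 0).
    { rewrite <- (is_derive_unique _ _ _ (is_derive_energy X Y t (hs t (Rlt_le _ _ ht)))).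
      apply is_derive_unique.
      apply is_derive_ext_loc with (fun _ => 0); [| apply @is_derive_const].
      exists (mkposreal (T - t) ltac:(lra)); intros s hs'.
      apply Rabs_lt_between' in hs'; simpl in hs'.
      symmetry; apply h0; lra. }
    assert (hl := dissipation_le _ _ hx hy).
    apply NNPP; intros hne.
    assert (0 < rpow (Rabs (al * X t - Y t)) (q + 1)) by (apply rpow_gt0; now apply Rabs_pos_lt).
    nra. }
  intros t ht.
  destruct (hs t (Rlt_le _ _ ht)) as [_ [_ [hx _]]].
  apply Rle_antisym; [| exact hx].
  apply le_epsilon; intros eps heps.
  destruct (hX eps heps) as [A hA].
  rewrite Rplus_0_l; apply Rle_trans with (2 := hA (Rmin A t) (Rmin_l _ _)).
  apply (nonincreasing_of_derive X (fun t => al * X t - Y t)); [apply Rmin_r | |].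
  - intros s hs'; apply hs; lra.
  - intros s hs'; rewrite hZ; lra.
Qed.

(** * Shape of the force and of the potential *)

Definition force_ratio (x : R) : R := rpow x (p - q) - al * K * rpow x (1 - q) - m * rpow al q.

Lemma force_factor (x : R) : 0 < x -> force x = rpow x q * force_ratio x.
Proof.
  intros hx; unfold force, force_ratio.
  replace (rpow x p) with (rpow x q * rpow x (p - q)) by (rewrite <- rpow_plus; f_equal; ring).
  replace x with (rpow x q * rpow x (1 - q)) at 3.
  - ring.
  - rewrite <- rpow_plus; replace (q + (1 - q)) with 1 by ring.
    rewrite rpow_pos by exact hx; now apply Rpower_1.
Qed.

(** The exponent [p - q] is positive, and the negative exponent [1 - q] enters with a minus sign.
    Hence the force has at most one positive zero, and is negative before it and positive after
    it. *)
Lemma force_ratio_increasing (x y : R) : 0 < x < y -> force_ratio x < force_ratio y.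
Proof.
  intros h; unfold force_ratio.
  assert (h1 : rpow x (p - q) < rpow y (p - q)) by (apply rpow_lt; lra).
  assert (h2 : rpow y (1 - q) < rpow x (1 - q)).
  { replace (1 - q) with (- (q - 1)) by ring.
    rewrite !rpow_pos by lra; rewrite !Rpower_Ropp.
    apply Rinv_lt_contravar; [apply Rmult_lt_0_compat; apply exp_pos |].
    apply Rlt_Rpower_l; lra. }
  assert (0 < al * K) by nra; nra.
Qed.

Lemma square_le_rpow (x : R) : 1 <= x -> x ^ 2 <= rpow x (q + 1).
Proof.
  intros h; rewrite rpow_pos by lra.
  rewrite <- Rpower_pow by lra; apply Rle_Rpower; simpl; lra.
Qed.

Lemma rpow_le_self (x : R) : 0 <= x <= 1 -> rpow x (q + 1) <= x.
Proof.
  intros h; rewrite rpow_succ by lra.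
  assert (h1 : rpow x q <= rpow 1 q) by (apply rpow_le; lra).
  rewrite rpow_1_l in h1; nra.
Qed.

Definition gradient_weight : R := m * rpow al q / (q + 1).

Lemma gradient_weight_gt0 : 0 < gradient_weight.
Proof.
  unfold gradient_weight; apply Rdiv_lt_0_compat; [| lra].
  apply Rmult_lt_0_compat; [exact m_gt0 | now apply rpow_gt0].
Qed.

Lemma potentialE (x : R) : potential x =
  rpow x (p + 1) / (p + 1) - al * K / 2 * x ^ 2 - gradient_weight * rpow x (q + 1).
Proof. unfold potential, gradient_weight; field; lra. Qed.

(** For [x >= 1] the quadratic term is dominated by [x^(q+1)], so negativity of the potential bounds
    [x^(p-q)]. The constant [C] is the value of [x^(p-q)] at which the leading term balances both
    negative terms after this replacement. *)
Lemma potential_neg_bounded :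
  exists B, 1 <= B /\ forall x, 0 <= x -> potential x < 0 -> x <= B.
Proof.
  set (C := (p + 1) * (al * K / 2 + gradient_weight)).
  assert (hc := gradient_weight_gt0); assert (hak : 0 < al * K) by nra.
  assert (hC : 0 < C) by (unfold C; apply Rmult_lt_0_compat; lra).
  exists (Rmax 1 (rpow C (/ (p - q)))); split; [apply Rmax_l |].
  intros x hx hV; apply Rnot_lt_le; intros hB.
  assert (h1 : 1 < x) by (apply Rle_lt_trans with (2 := hB), Rmax_l).
  assert (h2 : rpow C (/ (p - q)) < x) by (apply Rle_lt_trans with (2 := hB), Rmax_r).
  assert (h3 : C < rpow x (p - q)).
  { apply Rnot_le_lt; intros hle.
    assert (rpow (rpow C (/ (p - q))) (p - q) < rpow x (p - q))
      by (apply rpow_lt; lra).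
    assert (hp := rpow_gt0 C (/ (p - q)) hC).
    rewrite (rpow_pos (rpow _ _)), (rpow_pos C), Rpower_mult, Rinv_l, Rpower_1 in H; lra. }
  rewrite potentialE in hV.
  assert (h4 := square_le_rpow x (Rlt_le _ _ h1)).
  replace (p + 1) with ((p - q) + (q + 1)) in hV at 1 by ring.
  rewrite rpow_plus in hV.
  assert (h5 : 0 < rpow x (q + 1)) by (apply rpow_gt0; lra).
  set (a := rpow x (q + 1)) in *; set (b := rpow x (p - q)) in *.
  assert (h6 : C * a < b * a) by (apply Rmult_lt_compat_r; lra).
  assert (h7 : al * K / 2 * x ^ 2 <= al * K / 2 * a) by (apply Rmult_le_compat_l; lra).
  assert (h8 : C * a / (p + 1) = (al * K / 2 + gradient_weight) * a) by (unfold C; field; lra).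
  assert (h9 : C * a / (p + 1) < b * a / (p + 1)).
  { apply Rmult_lt_compat_r; [apply Rinv_0_lt_compat; lra | exact h6]. }
  nra.
Qed.

(** On [[0, 1]] both negative terms are at most linear in [x], so a potential below [e] needs [x] at
    least of order [- e]. *)
Lemma potential_neg_away (e : R) : e < 0 ->
  exists d, 0 < d /\ forall x, 0 <= x -> potential x <= e -> d <= x.
Proof.
  intros he.
  assert (hc := gradient_weight_gt0); assert (hak : 0 < al * K) by nra.
  set (C := al * K / 2 + gradient_weight).
  assert (hC : 0 < C) by (unfold C; lra).
  exists (Rmin 1 (- e / C)); split.
  - apply Rmin_pos; [lra | apply Rdiv_lt_0_compat; lra].
  - intros x hx hV; apply Rnot_lt_le; intros hlt.
    assert (h1 : x < 1) by (apply Rlt_le_trans with (1 := hlt), Rmin_l).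
    assert (h2 : x < - e / C) by (apply Rlt_le_trans with (1 := hlt), Rmin_r).
    assert (h3 : x * C < - e).
    { apply Rmult_lt_compat_r with (r := C) in h2; [| exact hC].
      unfold Rdiv in h2; rewrite Rmult_assoc, Rinv_l in h2; lra. }
    rewrite potentialE in hV.
    assert (h4 := rpow_le_self x (conj hx (Rlt_le _ _ h1))).
    assert (h5 : 0 <= rpow x (p + 1) / (p + 1)).
    { apply Rmult_le_pos; [apply rpow_ge0 | left; apply Rinv_0_lt_compat; lra]. }
    assert (h6 : x ^ 2 <= x) by nra.
    assert (al * K / 2 * x ^ 2 <= al * K / 2 * x) by (apply Rmult_le_compat_l; lra).
    assert (gradient_weight * rpow x (q + 1) <= gradient_weight * x) by (apply Rmult_le_compat_l; lra).
    unfold C in h3; nra.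
Qed.

Lemma potential_lower_bound (x B : R) : 0 <= x <= B ->
  - (al * K / 2 * B ^ 2 + gradient_weight * rpow B (q + 1)) <= potential x.
Proof.
  intros h; rewrite potentialE.
  assert (hc := gradient_weight_gt0); assert (hak : 0 < al * K) by nra.
  assert (h5 : 0 <= rpow x (p + 1) / (p + 1)).
  { apply Rmult_le_pos; [apply rpow_ge0 | left; apply Rinv_0_lt_compat; lra]. }
  assert (h1 : rpow x (q + 1) <= rpow B (q + 1)) by (apply rpow_le; lra).
  assert (h2 : x ^ 2 <= B ^ 2) by (apply pow_incr; lra).
  assert (al * K / 2 * x ^ 2 <= al * K / 2 * B ^ 2) by (apply Rmult_le_compat_l; lra).
  assert (gradient_weight * rpow x (q + 1) <= gradient_weight * rpow B (q + 1))
    by (apply Rmult_le_compat_l; lra).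
  lra.
Qed.


(** * Trajectories of negative energy *)

Definition velocity_rate (X Y : R -> R) (t : R) : R :=
  (al - K) * (al * X t - Y t) + m * (rpow (Y t) q - rpow (al * X t) q) - force (X t).

(** The potential lies below the negative energy, which confines [X] between [d] and [B]; the lower
    bound of the potential there limits the kinetic part. On this bounded range [y^q] is Lipschitz,
    so the acceleration without the force is [O(|X'|)]. *)
Lemma trajectory_bounded (X Y : R -> R) (t0 : R) :
  (forall t, t0 <= t -> solves X Y t) -> energy (X t0) (Y t0) < 0 ->
  exists d B c C D, 0 < d /\ 0 < c /\ 0 < D /\ forall t, t0 <= t ->
    d <= X t <= B /\
    C <= energy (X t) (Y t) /\
    Rabs (velocity_rate X Y t + force (X t)) <= c * Rabs (al * X t - Y t) /\
    Rabs (velocity_rate X Y t) <= D.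
Proof.
  intros hs hE.
  destruct potential_neg_bounded as [B [hB1 hB]].
  destruct (potential_neg_away _ hE) as [d [hd0 hd]].
  (* [P] bounds minus the potential on [[0, B]]. Then [X'^2 <= 2 P < Zm^2], [G] bounds both [al X]
     and [Y], [L] is a Lipschitz constant of [y^q] up to [G], and [F] bounds the force. *)
  set (P := al * K / 2 * B ^ 2 + gradient_weight * rpow B (q + 1)).
  set (Zm := 2 * P + 1).
  set (G := al * B + Zm).
  set (L := q * rpow G (q - 1)).
  set (c := (K - al) + m * L + 1).
  set (F := rpow B p + al * K * B + m * rpow al q * rpow B q).
  assert (hc := gradient_weight_gt0); assert (hak : 0 < al * K) by nra.
  assert (hP : 0 <= P).
  { unfold P; assert (h := rpow_ge0 B (q + 1)); nra. }
  assert (hL : 0 <= L) by (unfold L; assert (h := rpow_ge0 G (q - 1)); nra).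
  assert (hmL : 0 <= m * L) by (apply Rmult_le_pos; lra).
  assert (hc0 : 0 < c) by (unfold c; lra).
  assert (hF : 0 <= F).
  { unfold F; assert (h1 := rpow_ge0 B p); assert (h2 := rpow_ge0 B q).
    assert (h3 := rpow_ge0 al q).
    assert (0 <= m * rpow al q * rpow B q) by (repeat apply Rmult_le_pos; lra).
    assert (0 <= al * K * B) by (apply Rmult_le_pos; lra); lra. }
  exists d, B, c, (- P), (c * Zm + F + 1).
  assert (hcZ : 0 <= c * Zm) by (apply Rmult_le_pos; unfold Zm; lra).
  split; [exact hd0 | split; [exact hc0 | split; [lra |]]].
  intros t ht.
  destruct (hs t ht) as [_ [_ [hx hy]]].
  assert (hEt : energy (X t) (Y t) <= energy (X t0) (Y t0)).
  { apply energy_nonincreasing; [exact ht | intros; apply hs; lra]. }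
  assert (hZ2 : 0 <= (al * X t - Y t) ^ 2) by apply pow2_ge_0.
  assert (hVE : potential (X t) <= energy (X t) (Y t)) by (unfold energy; lra).
  assert (hXB : X t <= B) by (apply hB; lra).
  assert (hXd : d <= X t) by (apply hd; lra).
  assert (hV := potential_lower_bound (X t) B (conj hx hXB)); fold P in hV.
  assert (hZb : Rabs (al * X t - Y t) <= Zm).
  { assert (hsq : (al * X t - Y t) ^ 2 <= 2 * P) by (unfold energy in *; lra).
    apply Rabs_le; unfold Zm; split; nra. }
  assert (h0 := hZb); apply Rabs_le_between in h0.
  assert (haX : al * X t <= al * B) by (apply Rmult_le_compat_l; lra).
  assert (hZm : 1 <= Zm) by (unfold Zm; lra).
  assert (hlin : Rabs (velocity_rate X Y t + force (X t)) <= c * Rabs (al * X t - Y t)).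
  { unfold velocity_rate.
    replace ((al - K) * (al * X t - Y t) + m * (rpow (Y t) q - rpow (al * X t) q) - force (X t) + force (X t))
      with ((al - K) * (al * X t - Y t) + m * (rpow (Y t) q - rpow (al * X t) q)) by ring.
    apply Rle_trans with (1 := Rabs_triang _ _).
    rewrite !Rabs_mult, (Rabs_left1 (al - K)), (Rabs_pos_eq m) by lra.
    assert (hq : Rabs (rpow (Y t) q - rpow (al * X t) q) <= L * Rabs (al * X t - Y t)).
    { destruct (Rle_dec (Y t) (al * X t)) as [h | h].
      - destruct (rpow_lipschitz q G (Y t) (al * X t)) as [h1 h2]; [lra | unfold G; lra |].
        fold L in h2; rewrite Rabs_left1, Rabs_pos_eq; lra.
      - destruct (rpow_lipschitz q G (al * X t) (Y t)) as [h1 h2]; [lra | unfold G; lra |].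
        fold L in h2; rewrite Rabs_pos_eq, Rabs_left; lra. }
    apply Rmult_le_compat_l with (r := m) in hq; [| lra].
    assert (0 <= Rabs (al * X t - Y t)) by apply Rabs_pos.
    unfold c; nra. }
  split; [split; assumption | split; [lra | split; [exact hlin |]]].
  assert (hf : Rabs (force (X t)) <= F).
  { unfold force, F.
    assert (h1 : rpow (X t) p <= rpow B p) by (apply rpow_le; lra).
    assert (h2 : rpow (X t) q <= rpow B q) by (apply rpow_le; lra).
    assert (h3 := rpow_ge0 (X t) p); assert (h4 := rpow_ge0 (X t) q).
    assert (h5 : 0 < m * rpow al q) by (apply Rmult_lt_0_compat; [lra | now apply rpow_gt0]).
    assert (m * rpow al q * rpow (X t) q <= m * rpow al q * rpow B q) by (apply Rmult_le_compat_l; lra).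
    assert (0 <= m * rpow al q * rpow (X t) q) by (apply Rmult_le_pos; lra).
    assert (al * K * X t <= al * K * B) by (apply Rmult_le_compat_l; lra).
    assert (0 <= al * K * X t) by (apply Rmult_le_pos; lra).
    apply Rabs_le; split; lra. }
  replace (velocity_rate X Y t) with ((velocity_rate X Y t + force (X t)) + - force (X t)) by ring.
  apply Rle_trans with (1 := Rabs_triang _ _); rewrite Rabs_Ropp.
  assert (c * Rabs (al * X t - Y t) <= c * Zm) by (apply Rmult_le_compat_l; lra).
  lra.
Qed.

(* If [|X'|] exceeded [eps] at a late time, it would stay above [eps / 2] for a fixed time and dissipate a
   fixed amount of energy, more than is left. *)
Lemma velocity_vanishes (X Y : R -> R) (t0 : R) :
  (forall t, t0 <= t -> solves X Y t) -> energy (X t0) (Y t0) < 0 ->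
  forall eps, 0 < eps -> exists T, t0 <= T /\ forall t, T <= t -> Rabs (al * X t - Y t) <= eps.
Proof.
  intros hs hE eps heps.
  destruct (trajectory_bounded X Y t0 hs hE) as [d [B [c [C [D [hd [hc [hD hb]]]]]]]].
  (* With acceleration at most [D], the velocity changes by at most [eps / 2] during a time [h]. *)
  set (h := eps / (2 * D)).
  assert (hh : 0 < h) by (apply Rdiv_lt_0_compat; lra).
  (* A lower bound for the energy lost during [h] at speed at least [eps / 2]. *)
  set (eta := m * rpow (eps / 2) (q + 1) * h).
  assert (heta : 0 < eta).
  { unfold eta; assert (0 < rpow (eps / 2) (q + 1)) by (apply rpow_gt0; lra).
    apply Rmult_lt_0_compat; [apply Rmult_lt_0_compat |]; assumption. }
  destruct (near_infimum (fun t => energy (X t) (Y t)) t0 C eta) as [T [hT hinf]];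
    [intros t ht; apply hb; exact ht | exact heta |].
  exists T; split; [exact hT |]; intros t ht.
  apply Rnot_lt_le; intros hbig.
  assert (hst : forall s, t <= s <= t + h -> solves X Y s) by (intros; apply hs; lra).
  assert (hmono : energy (X t) (Y t) <= energy (X T) (Y T)).
  { apply energy_nonincreasing; [exact ht | intros; apply hs; lra]. }
  specialize (hinf (t + h) ltac:(lra)); simpl in hinf.
  destruct (mean_value (fun t => energy (X t) (Y t)) (fun t => dissipation (X t) (Y t)) t (t + h))
    as [s [hsr he]]; [lra | intros; apply is_derive_energy; auto |].
  destruct (hst s hsr) as [_ [_ [hx hy]]].
  assert (hdis := dissipation_le _ _ hx hy).
  assert (hvar : Rabs ((al * X s - Y s) - (al * X t - Y t)) <= eps / 2).
  { apply Rle_trans with (D * (s - t)).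
    - apply (variation_bound (fun t => al * X t - Y t) (velocity_rate X Y)); [lra | |].
      + intros; apply is_derive_velocity, hs; lra.
      + intros; apply hb; lra.
    - apply Rle_trans with (D * h); [apply Rmult_le_compat_l; lra |].
      unfold h; right; field; lra. }
  assert (hZ : eps / 2 <= Rabs (al * X s - Y s)).
  { assert (h' := Rabs_triang_inv (al * X t - Y t) (al * X s - Y s)).
    rewrite (Rabs_minus_sym (al * X t - Y t) (al * X s - Y s)) in h'; lra. }
  assert (hpow : rpow (eps / 2) (q + 1) <= rpow (Rabs (al * X s - Y s)) (q + 1)) by (apply rpow_le; lra).
  replace (t + h - t) with h in he by ring.
  assert (hfin : dissipation (X s) (Y s) * h <= - eta).
  { unfold eta; replace (- (m * rpow (eps / 2) (q + 1) * h)) with ((- m * rpow (eps / 2) (q + 1)) * h) by ring.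
    apply Rmult_le_compat_r; [lra |].
    apply Rmult_le_compat_l with (r := m) in hpow; lra. }
  lra.
Qed.

(* Once [X'] is small, [X] staying on one side of [xm] for a unit time would make [X''] bounded away from zero
   and hence move [X'] by a fixed amount. *)
Lemma trajectory_converges (X Y : R -> R) (t0 xm : R) :
  (forall t, t0 <= t -> solves X Y t) -> energy (X t0) (Y t0) < 0 ->
  0 < xm -> force xm = 0 ->
  forall eps, 0 < eps -> exists T, forall t, T <= t -> Rabs (X t - xm) <= eps.
Proof.
  intros hs hE hxm hroot eps' heps'.
  destruct (trajectory_bounded X Y t0 hs hE) as [d [B [c [C [D [hd [hc [hD hb]]]]]]]].
  (* The cap [xm / 2] keeps [xm - eps / 2] positive, where [force_ratio] is monotone. *)
  set (eps := Rmin eps' (xm / 2)).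
  assert (heps : 0 < eps) by (apply Rmin_pos; lra).
  assert (he1 : eps <= eps') by apply Rmin_l.
  assert (he2 : eps <= xm / 2) by apply Rmin_r.
  assert (hfr : force_ratio xm = 0).
  { rewrite force_factor in hroot by exact hxm.
    assert (h := rpow_gt0 xm q hxm).
    apply Rmult_integral in hroot; lra. }
  assert (hup : force_ratio xm < force_ratio (xm + eps / 2)) by (apply force_ratio_increasing; lra).
  assert (hlo : force_ratio (xm - eps / 2) < force_ratio xm) by (apply force_ratio_increasing; lra).
  assert (hdq : 0 < rpow d q) by now apply rpow_gt0.
  (* A lower bound for the absolute force where [X >= d] is at distance at least [eps / 2] from
     [xm]. *)
  set (kap := rpow d q * Rmin (force_ratio (xm + eps / 2)) (- force_ratio (xm - eps / 2))).
  assert (hkap : 0 < kap) by (apply Rmult_lt_0_compat; [exact hdq | apply Rmin_pos; lra]).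
  (* The first cap lets [X] move by at most [eps / 2] in unit time; the second makes [c |X'|] plus
     the change of [X'], together at most [(c + 2) zet], smaller than [kap]. *)
  set (zet := Rmin (eps / 2) (kap / (2 * (c + 2)))).
  assert (hzet : 0 < zet) by (apply Rmin_pos; [lra | apply Rdiv_lt_0_compat; lra]).
  assert (hz1 : zet <= eps / 2) by apply Rmin_l.
  assert (hz2 : (c + 2) * zet < kap).
  { apply Rle_lt_trans with ((c + 2) * (kap / (2 * (c + 2)))).
    - apply Rmult_le_compat_l; [lra | apply Rmin_r].
    - replace ((c + 2) * (kap / (2 * (c + 2)))) with (kap / 2) by (field; lra); lra. }
  destruct (velocity_vanishes X Y t0 hs hE zet hzet) as [T [hT hZ]].
  exists T; intros t ht; apply Rle_trans with (2 := he1).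
  assert (hnear : forall s, t <= s <= t + 1 -> Rabs (X s - X t) <= eps / 2).
  { intros s hsr; apply Rle_trans with (zet * (s - t)).
    - apply (variation_bound X (fun t => al * X t - Y t)); [lra | |].
      + intros; apply hs; lra.
      + intros; apply hZ; lra.
    - assert (zet * (s - t) <= zet * 1) by (apply Rmult_le_compat_l; lra); lra. }
  destruct (mean_value (fun t => al * X t - Y t) (velocity_rate X Y) t (t + 1)) as [s [hsr he]];
    [lra | intros; apply is_derive_velocity, hs; lra |].
  assert (hsx := hnear s hsr); apply Rabs_le_between in hsx.
  destruct (hb s ltac:(lra)) as [[hXd _] [_ [hlin _]]].
  apply Rabs_le_between in hlin.
  assert (hZs : c * Rabs (al * X s - Y s) <= c * zet) by (apply Rmult_le_compat_l; [lra | apply hZ; lra]).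
  assert (h1 := hZ t ltac:(lra)); apply Rabs_le_between in h1.
  assert (h2 := hZ (t + 1) ltac:(lra)); apply Rabs_le_between in h2.
  replace (t + 1 - t) with 1 in he by ring.
  assert (hXq : rpow d q <= rpow (X s) q) by (apply rpow_le; lra).
  rewrite (force_factor (X s)) in hlin by lra.
  assert (hm1 := Rmin_l (force_ratio (xm + eps / 2)) (- force_ratio (xm - eps / 2))).
  assert (hm2 := Rmin_r (force_ratio (xm + eps / 2)) (- force_ratio (xm - eps / 2))).
  assert (hm0 : 0 < Rmin (force_ratio (xm + eps / 2)) (- force_ratio (xm - eps / 2))) by (apply Rmin_pos; lra).
  apply Rabs_le; split; apply Rnot_lt_le; intros hfar.
  - assert (hr : force_ratio (X s) <= force_ratio (xm - eps / 2)).
    { destruct (Req_dec (X s) (xm - eps / 2)) as [-> | hne]; [lra |].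
      left; apply force_ratio_increasing; lra. }
    assert (kap <= rpow (X s) q * - force_ratio (X s)) by (apply Rmult_le_compat; lra).
    lra.
  - assert (hr : force_ratio (xm + eps / 2) <= force_ratio (X s)).
    { destruct (Req_dec (X s) (xm + eps / 2)) as [-> | hne]; [lra |].
      left; apply force_ratio_increasing; lra. }
    assert (kap <= rpow (X s) q * force_ratio (X s)) by (apply Rmult_le_compat; lra).
    lra.
Qed.

End Lyapunov.

(** * Asymptotics of ground states *)

Section Exponents.

Variables (N : nat) (p : R).
Hypotheses (N_ge3 : (3 <= N)%nat) (hp : (INR N + 2) / (INR N - 2) <= p).

Lemma INR_N_ge3 : 3 <= INR N.
Proof. apply le_INR in N_ge3; simpl in N_ge3; lra. Qed.

Lemma sobolev_ineq : INR N + 2 <= p * (INR N - 2).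
Proof.
  assert (h := INR_N_ge3).
  apply Rmult_le_compat_r with (r := INR N - 2) in hp; [| lra].
  unfold Rdiv in hp; rewrite Rmult_assoc, Rinv_l in hp; lra.
Qed.

Lemma p_gt1 : 1 < p.
Proof. assert (h := INR_N_ge3); assert (h' := sobolev_ineq); nra. Qed.

Lemma alpha_gt0 : 0 < 2 / (p - 1).
Proof. assert (h := p_gt1); apply Rdiv_lt_0_compat; lra. Qed.

Lemma q_gt1 : 1 < 2 * p / (p + 1).
Proof. assert (h := p_gt1); apply Rmult_lt_reg_r with (p + 1); [lra |]; field_simplify; lra. Qed.

Lemma q_lt_p : 2 * p / (p + 1) < p.
Proof. assert (h := p_gt1); apply Rmult_lt_reg_r with (p + 1); [lra |]; field_simplify; nra. Qed.

Lemma KexpE : Kexp N p = INR N - 2 - 2 / (p - 1).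
Proof. assert (h := p_gt1); unfold Kexp; field; lra. Qed.

(** After multiplication by [p - 1] this is [4 <= (N - 2) (p - 1)], the Sobolev condition, with
    equality at the critical exponent. *)
Lemma alpha_le_K : 2 / (p - 1) <= Kexp N p.
Proof.
  assert (h := p_gt1); assert (h' := sobolev_ineq); rewrite KexpE.
  apply Rmult_le_reg_r with (p - 1); [lra |].
  replace (2 / (p - 1) * (p - 1)) with 2 by (field; lra).
  replace ((INR N - 2 - 2 / (p - 1)) * (p - 1)) with ((INR N - 2) * (p - 1) - 2) by (field; lra).
  lra.
Qed.

End Exponents.

Section EmdenFowler.

Variables (N : nat) (p M : R).
Hypotheses (N_ge3 : (3 <= N)%nat) (hp : (INR N + 2) / (INR N - 2) <= p) (M_lt0 : M < 0).

Let al := 2 / (p - 1).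
Let q := 2 * p / (p + 1).
Let K := Kexp N p.

Definition scaled_u (u : R -> R) (t : R) : R := exp (al * t) * u (exp t).
Definition scaled_slope (du : R -> R) (t : R) : R := - (exp ((al + 1) * t) * du (exp t)).

Lemma emden_fowler (u du ddu : R -> R) (t : R) :
  is_derive u (exp t) (du (exp t)) -> is_derive du (exp t) (ddu (exp t)) ->
  0 <= u (exp t) -> du (exp t) <= 0 -> eqE N p M u du ddu (exp t) ->
  solves al K (- M) p q (scaled_u u) (scaled_slope du) t.
Proof.
  intros hu hdu h1 h2 he.
  assert (hp1 := p_gt1 N p N_ge3 hp).
  assert (e1 := exp_pos (al * t)); assert (e2 := exp_pos ((al + 1) * t)).
  assert (et := exp_pos t).
  assert (hexp1 : exp ((al + 1) * t) = exp (al * t) * exp t) by (rewrite <- exp_plus; f_equal; ring).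
  unfold solves, scaled_u, scaled_slope; split; [| split; [| split; nra]].
  - auto_derive; [now exists (du (exp t)) |].
    replace (Derive (fun x => u x) (exp t)) with (du (exp t)) by (symmetry; now apply is_derive_unique).
    rewrite hexp1; ring.
  - auto_derive; [now exists (ddu (exp t)) |].
    replace (Derive (fun x => du x) (exp t)) with (ddu (exp t)) by (symmetry; now apply is_derive_unique).
    unfold eqE in he; rewrite Rabs_pos_eq, Rabs_left1 in he by assumption.
    rewrite <- rpow_succ in he by exact h1.
    replace (p - 1 + 1) with p in he by ring; fold q in he.
    rewrite rpow_scal by exact e1.
    replace (- (exp ((al + 1) * t) * du (exp t))) with (exp ((al + 1) * t) * - du (exp t)) by ring.
    rewrite rpow_scal by exact e2.
    rewrite !rpow_exp.
    (* Both nonlinearities scale alike, since [p al = al + 2] and [q (al + 1) = al + 2]; this is why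
       [t] disappears from the system. *)
    replace (p * (al * t)) with (al * t + t + t) by (unfold al; field; lra).
    replace (q * ((al + 1) * t)) with (al * t + t + t) by (unfold al, q; field; lra).
    rewrite !exp_plus, hexp1.
    replace (ddu (exp t)) with (- ((INR N - 1) / exp t * du (exp t) + (rpow (u (exp t)) p
      + M * rpow (- du (exp t)) q))) by lra.
    unfold K; rewrite (KexpE N p N_ge3 hp); fold al; field; lra.
Qed.

Lemma filterlim_exp_m : filterlim exp (Rbar_locally m_infty) (at_right 0).
Proof.
  intros P [eps heps].
  destruct (is_lim_exp_m (ball 0 eps)) as [A hA]; [now exists eps |].
  exists A; intros t ht; apply heps; [now apply hA | apply exp_pos].
Qed.

Lemma filterlim_scaled (f : R -> R) (a l : R) : 0 < a ->
  filterlim f (at_right 0) (locally l) ->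
  filterlim (fun t => exp (a * t) * f (exp t)) (Rbar_locally m_infty) (locally 0).
Proof.
  intros ha hf.
  apply filterlim_ext with (fun t => (fun r => rpow r a * f r) (exp t)).
  - intros t; now rewrite rpow_exp.
  - apply (filterlim_comp _ _ _ exp (fun r => rpow r a * f r) _ (at_right 0)); [apply filterlim_exp_m |].
    replace (locally 0) with (locally (rpow 0 a * l)) by (rewrite rpow_nonpos, Rmult_0_l; [reflexivity | lra]).
    apply (filterlim_Rmult (at_right 0)); [| exact hf].
    eapply filterlim_filter_le_1; [apply filter_le_within | now apply continuous_rpow].
Qed.

(** Stated on [(0, exp T]] only, so that it also applies to a profile whose sign and equation are
    known just up to a zero. Finite limits at the origin make [X], [Y] and hence the energy tend to
    0 as [t] tends to minus infinity. *)
Lemma profile_energy_nonneg (u du ddu : R -> R) (u0 T : R) :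
  (forall r, 0 < r <= exp T -> is_derive u r (du r) /\ is_derive du r (ddu r) /\
     0 <= u r /\ du r <= 0 /\ eqE N p M u du ddu r) ->
  filterlim u (at_right 0) (locally u0) -> filterlim du (at_right 0) (locally 0) ->
  0 <= energy al K (- M) p q (scaled_u u T) (scaled_slope du T) ->
  forall r, 0 < r < exp T -> u r = 0.
Proof.
  intros hu hu0 hdu0 hE r hr.
  assert (hal : 0 < al) by (apply (alpha_gt0 N); assumption).
  assert (hq1 : 1 < q) by (apply (q_gt1 N); assumption).
  assert (hqp : q < p) by (apply (q_lt_p N); assumption).
  assert (haK : al <= K) by (apply alpha_le_K; assumption).
  assert (hX : filterlim (scaled_u u) (Rbar_locally m_infty) (locally 0))
    by now apply filterlim_scaled with u0.
  assert (hY : filterlim (scaled_slope du) (Rbar_locally m_infty) (locally 0)).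
  { replace (locally 0) with (Rbar_locally (Rbar_opp 0)) by (simpl; now rewrite Ropp_0).
    apply (is_lim_opp _ m_infty 0).
    apply filterlim_scaled with 0; [lra | exact hdu0]. }
  assert (hen : is_lim (fun t => energy al K (- M) p q (scaled_u u t) (scaled_slope du t)) m_infty 0).
  { unfold energy.
    replace 0 with ((al * 0 - 0) * ((al * 0 - 0) * 1) / 2 + potential al K (- M) p q 0)
      by (unfold potential; rewrite !(rpow_nonpos 0) by lra; field; lra).
    assert (hZ : is_lim (fun t => al * scaled_u u t - scaled_slope du t) m_infty (al * 0 - 0)).
    { apply is_lim_minus'; [apply (is_lim_scal_l _ al m_infty 0), hX | exact hY]. }
    apply is_lim_plus'.
    - unfold Rdiv; apply (is_lim_scal_r _ (/ 2) m_infty ((al * 0 - 0) * ((al * 0 - 0) * 1))); simpl.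
      apply (is_lim_mult _ _ m_infty (al * 0 - 0) ((al * 0 - 0) * 1)); [exact hZ | | easy].
      apply (is_lim_scal_r _ 1 m_infty (al * 0 - 0)), hZ.
    - unfold is_lim; eapply filterlim_comp; [apply hX |].
      apply (ex_derive_continuous (potential al K (- M) p q)); eexists.
      apply is_derive_potential; lra. }
  assert (hsmall : forall f, filterlim f (Rbar_locally m_infty) (locally 0) ->
    forall eps, 0 < eps -> exists A, forall t, t <= A -> f t <= eps).
  { intros f hf eps heps.
    destruct (hf (ball 0 (mkposreal eps heps)) (locally_ball _ _)) as [A hA].
    exists (A - 1); intros t ht.
    specialize (hA t ltac:(lra)); apply Rabs_lt_between' in hA; simpl in hA; lra. }
  assert (hz : scaled_u u (ln r) = 0).
  { apply (energy_nonneg_trivial al K (- M) p q hal haK ltac:(lra) hq1 hqp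
      (scaled_u u) (scaled_slope du) T).
    - intros t ht.
      assert (hr' : 0 < exp t <= exp T).
      { split; [apply exp_pos |].
        destruct ht as [ht | ->]; [left; now apply exp_increasing | right; reflexivity]. }
      destruct (hu (exp t) hr') as [h1 [h2 [h3 [h4 h5]]]].
      now apply emden_fowler with ddu.
    - apply hsmall, hen.
    - apply hsmall, hX.
    - exact hE.
    - apply exp_lt_inv; rewrite exp_ln; lra. }
  unfold scaled_u in hz; rewrite exp_ln in hz by lra.
  assert (h := exp_pos (al * ln r)).
  apply Rmult_integral in hz; lra.
Qed.

(* Where [u' > 0] the equation gives [(u'^(1-q))' >= - (q - 1) |M|], so [u'] cannot emerge from zero. *)
Lemma ground_state_slope_nonpos (u du ddu : R -> R) :
  C2_nonneg u du ddu -> (forall r, 0 <= r -> 0 <= u r) -> du 0 = 0 ->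
  (forall r, 0 < r -> eqE N p M u du ddu r) ->
  forall r, 0 < r -> du r <= 0.
Proof.
  intros [hu [hdu [_ [_ [hdu0 _]]]]] hpos h0 hode r1 hr1.
  assert (hq1 : 1 < q) by (apply (q_gt1 N); assumption).
  assert (hN := INR_N_ge3 N N_ge3).
  apply Rnot_lt_le; intros hlt.
  apply right_continuous_of_right_derivative in hdu0; rewrite h0 in hdu0.
  (* Extending the slope by 0 to nonpositive radii makes it continuous at the origin, so
     [last_crossing] applies on [[0, r1]]. *)
  set (f := fun r => if Rle_dec r 0 then 0 else du r).
  assert (hfdu : forall r, 0 < r -> f r = du r).
  { intros r hr; unfold f; destruct (Rle_dec r 0); [lra | reflexivity]. }
  assert (hf0 : forall r, r <= 0 -> f r = 0).
  { intros r hr; unfold f; destruct (Rle_dec r 0); [reflexivity | lra]. }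
  assert (hfc : forall r, 0 <= r <= r1 -> continuous f r).
  { intros r [[hr | <-] _].
    - apply continuous_ext_loc with du; [| apply (ex_derive_continuous du); eexists; now apply hdu].
      exists (mkposreal r hr); intros y hy; apply Rabs_lt_between' in hy; simpl in hy.
      symmetry; apply hfdu; lra.
    - apply filterlim_locally; intros eps.
      destruct (hdu0 (ball 0 eps) (locally_ball _ _)) as [del hdel].
      exists del; intros y hy; rewrite (hf0 0) by lra.
      destruct (Rlt_dec 0 y) as [h | h].
      + rewrite hfdu by exact h; now apply hdel.
      + rewrite hf0 by lra; apply ball_center. }
  destruct (last_crossing f 0 r1 0) as [r0 [hr0 [hfr0 hafter]]];
    [lra | exact hfc | rewrite hf0, hfdu by lra; lra |].
  assert (hw : forall r, r0 < r <= r1 -> 0 < du r).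
  { intros r hr; rewrite <- hfdu by lra; now apply hafter. }
  (* The bound on [u'^(1-q)] that results from integrating its derivative from [r] to [r1], with
     [r1 - r] enlarged to [r1]. *)
  set (G := Rpower (du r1) (1 - q) + (q - 1) * - M * r1).
  assert (hG : 0 < G).
  { unfold G; assert (0 < Rpower (du r1) (1 - q)) by apply exp_pos.
    assert (0 <= (q - 1) * - M * r1) by (repeat apply Rmult_le_pos; lra); lra. }
  assert (hbd : forall r, r0 < r <= r1 -> Rpower (du r) (1 - q) <= G).
  { intros r hr.
    destruct (mean_value (fun r => Rpower (du r) (1 - q))
      (fun r => ddu r * ((1 - q) * Rpower (du r) (1 - q - 1))) r r1) as [c [hc he]]; [lra | |].
    - intros s hs.
      apply (is_derive_comp (fun x => Rpower x (1 - q)) du).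
      + apply is_derive_Reals, derivable_pt_lim_power, hw; lra.
      + apply hdu; lra.
    - assert (hwc := hw c ltac:(lra)).
      assert (hoc := hode c ltac:(lra)); unfold eqE in hoc.
      rewrite (Rabs_pos_eq (du c)), (rpow_pos (du c)) in hoc by lra; fold q in hoc.
      assert (hpw : 0 <= rpow (Rabs (u c)) (p - 1) * u c)
        by (apply Rmult_le_pos; [apply rpow_ge0 | apply hpos; lra]).
      assert (hfr : 0 <= (INR N - 1) / c * du c).
      { apply Rmult_le_pos; [| lra]; apply Rmult_le_pos; [lra |].
        left; apply Rinv_0_lt_compat; lra. }
      (* The friction term and the power of [u] are nonnegative, leaving only the gradient term. *)
      assert (hdd : ddu c <= - M * Rpower (du c) q) by lra.
      assert (hprod : Rpower (du c) (1 - q - 1) * Rpower (du c) q = 1).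
      { rewrite <- Rpower_plus; replace (1 - q - 1 + q) with 0 by ring; now apply Rpower_O. }
      assert (hdp : 0 < Rpower (du c) (1 - q - 1)) by apply exp_pos.
      assert (hlow : - ((q - 1) * - M) <= ddu c * ((1 - q) * Rpower (du c) (1 - q - 1))).
      { apply Rmult_le_compat_r with (r := Rpower (du c) (1 - q - 1)) in hdd; [| lra].
        replace (- M * Rpower (du c) q * Rpower (du c) (1 - q - 1)) with (- M) in hdd
          by (rewrite Rmult_assoc, (Rmult_comm (Rpower (du c) q)), hprod; ring).
        nra. }
      assert (hmul : - ((q - 1) * - M) * (r1 - r)
        <= ddu c * ((1 - q) * Rpower (du c) (1 - q - 1)) * (r1 - r))
        by (apply Rmult_le_compat_r; lra).
      assert (0 <= (q - 1) * - M * r) by (repeat apply Rmult_le_pos; lra).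
      unfold G; lra. }
  (* This is [G^(-1/(q-1))]: a bounded negative power keeps [u'] away from 0, against continuity at
     [r0]. *)
  set (w0 := exp (- (ln G / (q - 1)))).
  assert (hw0 : 0 < w0) by apply exp_pos.
  assert (hge : forall r, r0 < r <= r1 -> w0 <= du r).
  { intros r hr; specialize (hbd r hr); specialize (hw r hr).
    rewrite <- (exp_ln (du r)) by exact hw.
    assert (hln : (1 - q) * ln (du r) <= ln G).
    { rewrite <- (ln_exp ((1 - q) * ln (du r))).
      destruct hbd as [h | h].
      - left; apply ln_increasing; [apply exp_pos | exact h].
      - right; now f_equal. }
    assert (hl : - (ln G / (q - 1)) <= ln (du r)).
    { apply Rmult_le_reg_r with (q - 1); [lra |].
      replace (- (ln G / (q - 1)) * (q - 1)) with (- ln G) by (field; lra); lra. }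
    unfold w0; destruct hl as [h | ->]; [left; now apply exp_increasing | right; reflexivity]. }
  assert (hc0 : continuous f r0) by (apply hfc; lra).
  destruct (proj1 (filterlim_locally _ _) hc0 (mkposreal w0 hw0)) as [del hdel].
  assert (hd := cond_pos del).
  set (r := Rmin r1 (r0 + del / 2)).
  assert (hx1 : r0 < r) by (apply Rmin_glb_lt; lra).
  assert (hx2 : r <= r1) by apply Rmin_l.
  assert (hx3 : r <= r0 + del / 2) by apply Rmin_r.
  assert (h := hdel r ltac:(apply Rabs_lt_between'; lra)).
  apply Rabs_lt_between' in h; simpl in h.
  rewrite hfr0, hfdu in h by lra.
  specialize (hge r (conj hx1 hx2)); lra.
Qed.

(** Multiplying the equation by [X] produces the force, since [(p - 1) / (p + 1) = q - 1]. *)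
Lemma is_XM_force (X : R) : is_XM N p M X -> 0 < X /\ force al K (- M) p q X = 0.
Proof.
  intros [hX he]; split; [exact hX |].
  assert (hp1 := p_gt1 N p N_ge3 hp).
  unfold force.
  replace (rpow X p) with (rpow X (p - 1) * X) by (rewrite <- rpow_succ by lra; f_equal; ring).
  replace (rpow X q) with (rpow X ((p - 1) / (p + 1)) * X)
    by (rewrite <- rpow_succ by lra; f_equal; unfold q; field; lra).
  fold al q in he; fold K in he.
  replace (2 * K / (p - 1)) with (al * K) in he by (unfold al; field; lra).
  transitivity (X * (rpow X (p - 1) + M * rpow al q * rpow X ((p - 1) / (p + 1)) - al * K)); [ring |].
  rewrite he; ring.
Qed.

Lemma ground_state_asymptotics (u : R -> R) :
  ground_state N p M u -> (exists r, 0 <= r /\ u r <> 0) ->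
  forall X, is_XM N p M X -> is_lim (fun r => u r / U_M p X r) p_infty 1.
Proof.
  intros [du [ddu [hC [hpos [h0 hode]]]]] hnt X hX.
  destruct (is_XM_force X hX) as [hX0 hXf].
  assert (hal : 0 < al) by (apply (alpha_gt0 N); assumption).
  assert (hq1 : 1 < q) by (apply (q_gt1 N); assumption).
  assert (hqp : q < p) by (apply (q_lt_p N); assumption).
  assert (haK : al <= K) by (apply alpha_le_K; assumption).
  assert (hle := ground_state_slope_nonpos u du ddu hC hpos h0 hode).
  destruct hC as [hu [hdu [_ [hu0 [hdu0 _]]]]].
  apply right_continuous_of_right_derivative in hu0, hdu0; rewrite h0 in hdu0.
  assert (hnt' : exists r, 0 < r /\ 0 < u r).
  { destruct hnt as [r [[hr | <-] hne]].
    - exists r; split; [exact hr |]; specialize (hpos r ltac:(lra)); lra.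
    - specialize (hpos 0 ltac:(lra)).
      destruct (hu0 (ball (u 0) (mkposreal (u 0) ltac:(lra))) (locally_ball _ _)) as [del hdel].
      assert (hd := cond_pos del).
      exists (del / 2); split; [lra |].
      assert (h := hdel (del / 2) ltac:(apply Rabs_lt_between'; lra) ltac:(lra)).
      apply Rabs_lt_between' in h; simpl in h; lra. }
  destruct hnt' as [r1 [hr1 hur1]].
  (* This puts [r1] strictly inside [(0, exp t0)], where nonnegative energy would give [u = 0]. *)
  set (t0 := ln (r1 + 1)).
  assert (hsol : forall t, solves al K (- M) p q (scaled_u u) (scaled_slope du) t).
  { intros t; assert (et := exp_pos t).
    apply emden_fowler with ddu; [apply hu | apply hdu | apply hpos | apply hle | apply hode]; lra. }
  assert (hE : energy al K (- M) p q (scaled_u u t0) (scaled_slope du t0) < 0).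
  { apply Rnot_le_lt; intros hge.
    assert (u r1 = 0); [| lra].
    apply (profile_energy_nonneg u du ddu (u 0) t0); try assumption.
    - intros r hr.
      split; [| split; [| split; [| split]]]; [apply hu | apply hdu | apply hpos | apply hle | apply hode]; lra.
    - unfold t0; rewrite exp_ln; lra. }
  apply is_lim_spec; intros eps.
  (* The quotient [u / U_M] is the scaled solution divided by [X], so the tolerance is taken
     proportional to [X]. *)
  destruct (trajectory_converges al K (- M) p q hal haK ltac:(lra) hq1 hqp (scaled_u u) (scaled_slope du)
    t0 X (fun t _ => hsol t) hE hX0 hXf (eps / 2 * X)) as [T hT].
  { assert (he := cond_pos eps); apply Rmult_lt_0_compat; lra. }
  exists (exp T); intros r hr.
  assert (hrpos : 0 < r) by (apply Rlt_trans with (2 := hr), exp_pos).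
  assert (hTr : T <= ln r).
  { left; apply exp_lt_inv; now rewrite exp_ln. }
  specialize (hT (ln r) hTr).
  unfold scaled_u in hT; rewrite exp_ln in hT by exact hrpos.
  unfold U_M; fold al; rewrite rpow_pos by exact hrpos.
  rewrite Rpower_Ropp; unfold Rpower.
  assert (ha := exp_pos (al * ln r)).
  set (a := exp (al * ln r)) in *.
  replace (u r / (X * / a) - 1) with ((a * u r - X) / X) by (field; lra).
  unfold Rdiv; rewrite Rabs_mult, (Rabs_pos_eq (/ X)) by (left; now apply Rinv_0_lt_compat).
  apply Rle_lt_trans with (eps / 2 * X * / X).
  - apply Rmult_le_compat_r; [left; now apply Rinv_0_lt_compat | exact hT].
  - rewrite Rmult_assoc, Rinv_r by lra; assert (he := cond_pos eps); lra.
Qed.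

End EmdenFowler.

(** * Picard iteration at the singular point *)

Lemma is_derive_RInt_0 (f : R -> R) (r : R) :
  (forall x, continuous f x) -> is_derive (fun r => RInt f 0 r) r (f r).
Proof.
  intros hf; apply is_derive_RInt with 0; [| apply hf].
  apply filter_forall; intros x; apply (@RInt_correct R_CompleteNormedModule).
  apply (@ex_RInt_continuous R_CompleteNormedModule); intros; apply hf.
Qed.

Lemma RInt_0_0 (f : R -> R) : RInt f 0 0 = 0.
Proof. apply (@RInt_point R_CompleteNormedModule). Qed.

(** [f - g] is nonincreasing and [f + g] nondecreasing; this replaces estimates under the integral
    sign. *)
Lemma growth_bound (f df g dg : R -> R) (a b : R) : a <= b ->
  (forall x, a <= x <= b -> is_derive f x (df x)) ->
  (forall x, a <= x <= b -> is_derive g x (dg x)) ->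
  (forall x, a <= x <= b -> Rabs (df x) <= dg x) -> Rabs (f b - f a) <= g b - g a.
Proof.
  intros hab hf hg hd.
  assert (h1 : f b - g b <= f a - g a).
  { apply (nonincreasing_of_derive (fun x => f x - g x) (fun x => df x - dg x)); [exact hab | |].
    - intros x hx; apply @is_derive_minus; auto.
    - intros x hx; specialize (hd x hx); apply Rabs_le_between in hd; lra. }
  assert (h2 : f a + g a <= f b + g b).
  { apply (nondecreasing_of_derive (fun x => f x + g x) (fun x => df x + dg x)); [exact hab | |].
    - intros x hx; apply @is_derive_plus; auto.
    - intros x hx; specialize (hd x hx); apply Rabs_le_between in hd; lra. }
  apply Rabs_le; lra.
Qed.

(** The integral minus [g 0 * r^(k+1) / (k+1)] has derivative [r^k (g r - g 0)], so one mean value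
    and continuity of [g] at 0 suffice. With [k = N - 1] it yields the second derivative at the
    origin. *)
Lemma weighted_mean_limit (g : R -> R) (k : nat) (eps : R) :
  (forall x, continuous g x) -> 0 < eps ->
  exists del, 0 < del /\ forall h, 0 < h < del ->
    Rabs (RInt (fun s => s ^ k * g s) 0 h / h ^ k / h - g 0 / INR (S k)) < eps.
Proof.
  intros hg heps.
  destruct (proj1 (filterlim_locally _ _) (hg 0) (mkposreal (eps / 2) ltac:(lra))) as [del hdel].
  assert (hw : forall x, continuous (fun s => s ^ k * g s) x).
  { intros x; apply (continuous_mult (fun s => s ^ k) g); [| apply hg].
    apply (ex_derive_continuous (fun s => s ^ k)); now auto_derive. }
  assert (hk : 0 < INR (S k)) by (apply lt_0_INR; lia).
  exists del; split; [apply cond_pos |]; intros h hh.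
  destruct (mean_value (fun r => RInt (fun s => s ^ k * g s) 0 r - g 0 * (r ^ S k / INR (S k)))
    (fun r => r ^ k * g r - g 0 * r ^ k) 0 h) as [c [hc he]]; [lra | |].
  - intros x _; apply @is_derive_minus; [now apply (is_derive_RInt_0 (fun s => s ^ k * g s)) |].
    auto_derive; [trivial |]; change (match k with 0%nat => 1 | S _ => INR k + 1 end) with (INR (S k)).
    simpl Nat.pred; field; lra.
  - simpl in he; rewrite RInt_0_0, Rmult_0_l in he.
    assert (hgc := hdel c ltac:(apply Rabs_lt_between'; lra)).
    change (Rabs (g c - g 0) < eps / 2) in hgc.
    assert (hhk : 0 < h ^ k) by (apply pow_lt; lra).
    replace (RInt (fun s => s ^ k * g s) 0 h / h ^ k / h - g 0 / INR (S k))
      with ((c ^ k / h ^ k) * (g c - g 0)).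
    + rewrite Rabs_mult.
      assert (hck : 0 <= c ^ k <= h ^ k) by (split; [apply pow_le | apply pow_incr]; lra).
      rewrite Rabs_pos_eq by (apply Rdiv_le_0_compat; lra).
      assert (c ^ k / h ^ k <= 1) by (apply Rle_div_l; lra).
      assert (h0 := Rabs_pos (g c - g 0)).
      assert (c ^ k / h ^ k * Rabs (g c - g 0) <= 1 * Rabs (g c - g 0)) by (apply Rmult_le_compat_r; lra).
      lra.
    + change (match k with 0%nat => 1 | S _ => INR k + 1 end) with (INR (S k)) in he.
      replace (RInt (fun s => s ^ k * g s) 0 h)
        with (g 0 * (h * h ^ k / INR (S k)) + (c ^ k * g c - g 0 * c ^ k) * h) by lra.
      field; lra.
Qed.

Section Picard.

Variables (F : R -> R -> R) (k : nat) (L C : R).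
Hypotheses
  (F_lipschitz : forall u v u' v', Rabs (F u v - F u' v') <= L * (Rabs (u - u') + Rabs (v - v')))
  (F_bounded : forall u v, Rabs (F u v) <= C).

(** With [v = - u'], [u 0 = 1] and [k = N - 1], the equation reads [(r^k v)' = r^k F(u, v)]; in this
    integrated form the singular coefficient [(N - 1) / r] is gone. *)
Definition height (v : R -> R) (r : R) : R := 1 - RInt v 0 r.
Definition source (v : R -> R) (r : R) : R := F (height v r) (v r).
Definition flux (v : R -> R) (r : R) : R := RInt (fun s => s ^ k * source v s) 0 r.

(* The value 0 on negative radii keeps every iterate continuous on the whole line. *)
Definition picard_step (v : R -> R) (r : R) : R := if Rle_dec r 0 then 0 else flux v r / r ^ k.

Fixpoint picard (n : nat) : R -> R :=
  match n with O => fun _ => 0 | S n => picard_step (picard n) end.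

Lemma L_ge0 : 0 <= L.
Proof.
  assert (h := F_lipschitz 1 0 0 0); assert (h' := Rabs_pos (F 1 0 - F 0 0)).
  rewrite !Rminus_0_r, Rabs_R0, Rabs_R1 in h; lra.
Qed.

Lemma C_ge0 : 0 <= C.
Proof. assert (h := F_bounded 0 0); assert (h' := Rabs_pos (F 0 0)); lra. Qed.

Lemma is_derive_height (v : R -> R) (r : R) :
  (forall x, continuous v x) -> is_derive (height v) r (- v r).
Proof.
  intros hv; replace (- v r) with (minus 0 (v r)) by (unfold minus, plus, opp; simpl; ring).
  apply @is_derive_minus; [apply @is_derive_const | now apply is_derive_RInt_0].
Qed.

Lemma continuous_source (v : R -> R) (r : R) :
  (forall x, continuous v x) -> continuous (source v) r.
Proof.
  intros hv; assert (hh : continuous (height v) r).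
  { apply (ex_derive_continuous (height v)); eexists; now apply is_derive_height. }
  apply filterlim_locally; intros eps.
  assert (hL := L_ge0); assert (he := cond_pos eps).
  assert (hp : 0 < eps / (2 * L + 1)) by (apply Rdiv_lt_0_compat; lra).
  assert (h1 := proj1 (filterlim_locally _ _) hh (mkposreal _ hp)).
  assert (h2 := proj1 (filterlim_locally _ _) (hv r) (mkposreal _ hp)).
  generalize (filter_and _ _ h1 h2); apply filter_imp; intros x [hx1 hx2].
  change (Rabs (height v x - height v r) < eps / (2 * L + 1)) in hx1.
  change (Rabs (v x - v r) < eps / (2 * L + 1)) in hx2.
  change (Rabs (source v x - source v r) < eps).
  apply Rle_lt_trans with (1 := F_lipschitz _ _ _ _).
  apply Rle_lt_trans with (L * (2 * (eps / (2 * L + 1)))); [apply Rmult_le_compat_l; lra |].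
  replace (L * (2 * (eps / (2 * L + 1)))) with (eps - eps / (2 * L + 1)) by (field; lra); lra.
Qed.

Lemma is_derive_flux (v : R -> R) (r : R) :
  (forall x, continuous v x) -> is_derive (flux v) r (r ^ k * source v r).
Proof.
  intros hv; apply (is_derive_RInt_0 (fun s => s ^ k * source v s)); intros x.
  apply (continuous_mult (fun s => s ^ k) (source v)); [| now apply continuous_source].
  apply (ex_derive_continuous (fun s => s ^ k)); now auto_derive.
Qed.

Lemma picard_step_pos (v : R -> R) (r : R) : 0 < r -> picard_step v r = flux v r / r ^ k.
Proof. intros h; unfold picard_step; destruct (Rle_dec r 0); [lra | reflexivity]. Qed.

Lemma picard_step_nonpos (v : R -> R) (r : R) : r <= 0 -> picard_step v r = 0.
Proof. intros h; unfold picard_step; destruct (Rle_dec r 0); [reflexivity | lra]. Qed.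

(** The mean value theorem writes the flux as [c^k] times a bounded source times [r], with [c <= r],
    so the singular weight cancels. The linear bound gives continuity at the origin and starts the
    iteration. *)
Lemma picard_step_bound (v : R -> R) (r : R) :
  (forall x, continuous v x) -> 0 <= r -> Rabs (picard_step v r) <= C * r.
Proof.
  intros hv [hr | <-]; [| rewrite picard_step_nonpos, Rabs_R0, Rmult_0_r; lra].
  rewrite picard_step_pos by exact hr.
  destruct (mean_value (flux v) (fun r => r ^ k * source v r) 0 r) as [c [hc he]];
    [lra | intros; now apply is_derive_flux |].
  unfold flux in he at 2; rewrite RInt_0_0, !Rminus_0_r in he; rewrite he.
  assert (hrk : 0 < r ^ k) by (apply pow_lt; lra).
  assert (hck : 0 <= c ^ k <= r ^ k) by (split; [apply pow_le | apply pow_incr]; lra).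
  replace (c ^ k * source v c * r / r ^ k) with ((c ^ k / r ^ k) * (source v c * r)) by (field; lra).
  rewrite !Rabs_mult, (Rabs_pos_eq r), (Rabs_pos_eq (c ^ k / r ^ k)) by (try apply Rdiv_le_0_compat; lra).
  assert (c ^ k / r ^ k <= 1) by (apply Rle_div_l; lra).
  assert (0 <= c ^ k / r ^ k) by (apply Rdiv_le_0_compat; lra).
  rewrite <- (Rmult_1_l (C * r)); apply Rmult_le_compat; try lra.
  - apply Rmult_le_pos; [apply Rabs_pos | lra].
  - apply Rmult_le_compat_r; [lra | apply F_bounded].
Qed.

Lemma continuous_picard_step (v : R -> R) (r : R) :
  (forall x, continuous v x) -> continuous (picard_step v) r.
Proof.
  intros hv; assert (hC := C_ge0); destruct (Rtotal_order r 0) as [h | [-> | h]].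
  - apply continuous_ext_loc with (fun _ => 0); [| apply continuous_const].
    exists (mkposreal (- r) ltac:(lra)); intros y hy.
    apply Rabs_lt_between' in hy; simpl in hy; rewrite picard_step_nonpos; [reflexivity | lra].
  - apply filterlim_locally; intros eps; assert (he := cond_pos eps).
    exists (mkposreal (eps / (C + 1)) ltac:(apply Rdiv_lt_0_compat; lra)); intros y hy.
    change (Rabs (y - 0) < eps / (C + 1)) in hy; rewrite Rminus_0_r in hy.
    change (Rabs (picard_step v y - picard_step v 0) < eps).
    rewrite (picard_step_nonpos v 0), Rminus_0_r by lra.
    destruct (Rle_dec y 0) as [h | h]; [rewrite picard_step_nonpos, Rabs_R0; lra |].
    rewrite Rabs_pos_eq in hy by lra.
    apply Rle_lt_trans with (1 := picard_step_bound v y hv ltac:(lra)).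
    apply Rle_lt_trans with (C * (eps / (C + 1))); [apply Rmult_le_compat_l; lra |].
    replace (C * (eps / (C + 1))) with (eps - eps / (C + 1)) by (field; lra).
    assert (0 < eps / (C + 1)) by (apply Rdiv_lt_0_compat; lra); lra.
  - apply continuous_ext_loc with (fun y => flux v y / y ^ k).
    + exists (mkposreal r h); intros y hy.
      apply Rabs_lt_between' in hy; simpl in hy; rewrite picard_step_pos; [reflexivity | lra].
    + assert (hrk : 0 < r ^ k) by (apply pow_lt; lra).
      apply (ex_derive_continuous (fun y => flux v y / y ^ k)).
      apply ex_derive_div; [eexists; now apply is_derive_flux | now auto_derive | lra].
Qed.

(** [4 L <= rate] brings the factor [2 L / rate] of the flux estimate down to [1 / 2]; [rate >= 1]
    lets the heights inherit the bound on the slopes. *)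
Let rate := 4 * L + 1.

(* In the norm weighted by [exp (- rate r)], a large rate makes the Picard map a contraction on all of [0, oo). *)
Lemma picard_step_contraction (v w : R -> R) (A : R) :
  (forall x, continuous v x) -> (forall x, continuous w x) ->
  (forall r, 0 <= r -> Rabs (v r - w r) <= A * exp (rate * r)) ->
  forall r, 0 <= r -> Rabs (picard_step v r - picard_step w r) <= A / 2 * exp (rate * r).
Proof.
  intros hv hw hA r hr; assert (hL := L_ge0); assert (hrate : 1 <= rate) by (unfold rate; lra).
  assert (hA0 : 0 <= A).
  { specialize (hA 0 ltac:(lra)); rewrite Rmult_0_r, exp_0 in hA.
    assert (h := Rabs_pos (v 0 - w 0)); lra. }
  destruct hr as [hr | <-].
  2: { rewrite !picard_step_nonpos by lra; rewrite Rminus_0_r, Rabs_R0.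
       assert (h := exp_pos (rate * 0)); nra. }
  assert (hexp : forall c x, is_derive (fun x => c / rate * exp (rate * x)) x (c * exp (rate * x))).
  { intros c x; auto_derive; [trivial | field; lra]. }
  assert (hh : forall s, 0 <= s -> Rabs (height v s - height w s) <= A * exp (rate * s)).
  { intros s hs.
    assert (h := growth_bound (fun s => height v s - height w s) (fun s => - v s - - w s)
      (fun x => A / rate * exp (rate * x)) (fun x => A * exp (rate * x)) 0 s hs
      ltac:(intros; apply @is_derive_minus; now apply is_derive_height) ltac:(intros; apply hexp)).
    unfold height in h at 3 4; rewrite !RInt_0_0 in h.
    replace (height v s - height w s - (1 - 0 - (1 - 0))) with (height v s - height w s) in h by ring.
    apply Rle_trans with (A / rate * exp (rate * s) - A / rate * exp (rate * 0)).
    - apply h; intros x hx; replace (- v x - - w x) with (- (v x - w x)) by ring.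
      rewrite Rabs_Ropp; apply hA; lra.
    - assert (h1 : 0 <= A / rate <= A).
      { split; [apply Rdiv_le_0_compat; lra | apply Rle_div_l; [lra | nra]]. }
      assert (0 < exp (rate * s)) by apply exp_pos; assert (0 < exp (rate * 0)) by apply exp_pos.
      assert (A / rate * exp (rate * s) <= A * exp (rate * s)) by (apply Rmult_le_compat_r; lra).
      assert (0 <= A / rate * exp (rate * 0)) by (apply Rmult_le_pos; lra).
      lra. }
  assert (hrk : 0 < r ^ k) by (apply pow_lt; lra).
  (* Height and slope each contribute [L A exp (rate x)] to the source difference, and [x^k <= r^k];
     integrating the exponential gains [1 / rate]. *)
  assert (hfl : Rabs (flux v r - flux w r) <= r ^ k * (A / 2 * exp (rate * r))).
  { assert (h := growth_bound (fun s => flux v s - flux w s)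
      (fun s => s ^ k * source v s - s ^ k * source w s)
      (fun x => r ^ k * (2 * L * A) / rate * exp (rate * x)) (fun x => r ^ k * (2 * L * A) * exp (rate * x)) 0 r
      (Rlt_le _ _ hr) ltac:(intros; apply @is_derive_minus; now apply is_derive_flux)
      ltac:(intros; apply hexp)).
    unfold flux in h at 3 4; rewrite !RInt_0_0, !Rminus_0_r in h.
    apply Rle_trans with (r ^ k * (2 * L * A) / rate * exp (rate * r)
      - r ^ k * (2 * L * A) / rate * exp (rate * 0)).
    - apply h; intros x hx.
      rewrite <- Rmult_minus_distr_l, Rabs_mult.
      assert (hxk : 0 <= x ^ k <= r ^ k) by (split; [apply pow_le | apply pow_incr]; lra).
      rewrite (Rabs_pos_eq (x ^ k)), Rmult_assoc by lra.
      apply Rmult_le_compat; [lra | apply Rabs_pos | lra |].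
      apply Rle_trans with (1 := F_lipschitz _ _ _ _).
      specialize (hh x ltac:(lra)); specialize (hA x ltac:(lra)).
      apply Rle_trans with (L * (2 * (A * exp (rate * x)))); [apply Rmult_le_compat_l; lra | right; ring].
    - assert (0 < exp (rate * r)) by apply exp_pos; assert (0 < exp (rate * 0)) by apply exp_pos.
      assert (h1 : 0 <= r ^ k * (2 * L * A) / rate).
      { apply Rdiv_le_0_compat; [| lra]; repeat apply Rmult_le_pos; lra. }
      assert (h2 : r ^ k * (2 * L * A) / rate <= r ^ k * (A / 2)).
      { apply Rle_div_l; [lra |]; rewrite (Rmult_assoc (r ^ k) (A / 2)); apply Rmult_le_compat_l; [lra |].
        unfold rate; nra. }
      assert (r ^ k * (2 * L * A) / rate * exp (rate * r) <= r ^ k * (A / 2) * exp (rate * r))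
        by (apply Rmult_le_compat_r; lra).
      assert (0 <= r ^ k * (2 * L * A) / rate * exp (rate * 0)) by (apply Rmult_le_pos; lra).
      lra. }
  rewrite !picard_step_pos by exact hr.
  replace (flux v r / r ^ k - flux w r / r ^ k) with ((flux v r - flux w r) / r ^ k) by (field; lra).
  unfold Rdiv at 1; rewrite Rabs_mult, (Rabs_pos_eq (/ r ^ k)) by (left; now apply Rinv_0_lt_compat).
  apply Rmult_le_reg_r with (r ^ k); [exact hrk |].
  rewrite Rmult_assoc, Rinv_l by lra; lra.
Qed.

Lemma continuous_picard (n : nat) (r : R) : continuous (picard n) r.
Proof.
  revert r; induction n as [| n IH]; intros r; [apply continuous_const |].
  now apply continuous_picard_step.
Qed.

Lemma picard_nonpos (n : nat) (r : R) : r <= 0 -> picard n r = 0.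
Proof. intros h; destruct n; [reflexivity | now apply picard_step_nonpos]. Qed.

Lemma picard_increment (n : nat) (r : R) : 0 <= r ->
  Rabs (picard (S n) r - picard n r) <= C * (/ 2) ^ n * exp (rate * r).
Proof.
  revert r; induction n as [| n IH]; intros r hr.
  - simpl picard; rewrite Rminus_0_r, pow_O, Rmult_1_r.
    apply Rle_trans with (C * r).
    + apply picard_step_bound; [intros; apply continuous_const | exact hr].
    + apply Rmult_le_compat_l; [apply C_ge0 |].
      assert (h := exp_ineq1_le (rate * r)); assert (hL := L_ge0).
      assert (r <= rate * r) by (unfold rate; nra); lra.
  - replace (C * (/ 2) ^ S n * exp (rate * r)) with ((C * (/ 2) ^ n) / 2 * exp (rate * r)) by (simpl; field).
    apply picard_step_contraction; [apply (continuous_picard (S n)) | apply continuous_picard | exact IH | exact hr].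
Qed.

Lemma picard_cauchy (n j : nat) (r : R) : 0 <= r ->
  Rabs (picard (n + j) r - picard n r) <= 2 * C * (/ 2) ^ n * exp (rate * r).
Proof.
  intros hr; assert (hC := C_ge0); assert (he := exp_pos (rate * r)).
  assert (hhalf : forall i, 0 < (/ 2) ^ i) by (intros; apply pow_lt; lra).
  (* The induction on [j] needs the telescoping form of the geometric bound, with the tail
     subtracted. *)
  enough (h : Rabs (picard (n + j) r - picard n r)
    <= (2 * C * (/ 2) ^ n - 2 * C * (/ 2) ^ (n + j)) * exp (rate * r)).
  { assert (0 <= 2 * C * (/ 2) ^ (n + j) * exp (rate * r)).
    { specialize (hhalf (n + j)%nat); repeat apply Rmult_le_pos; lra. }
    lra. }
  induction j as [| j IH].
  - rewrite Nat.add_0_r, !Rminus_diag, Rabs_R0; lra.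
  - rewrite Nat.add_succ_r.
    assert (h1 := picard_increment (n + j) r hr).
    replace (picard (S (n + j)) r - picard n r)
      with ((picard (S (n + j)) r - picard (n + j) r) + (picard (n + j) r - picard n r)) by ring.
    apply Rle_trans with (1 := Rabs_triang _ _); simpl pow; lra.
Qed.

Definition picard_limit (r : R) : R := real (Lim_seq (fun n => picard n r)).

Lemma half_pow_small (B eps : R) : 0 <= B -> 0 < eps -> exists n0, forall n, (n0 <= n)%nat -> B * (/ 2) ^ n < eps.
Proof.
  intros hB heps.
  assert (hp : 0 < eps / (B + 1)) by (apply Rdiv_lt_0_compat; lra).
  destruct (pow_lt_1_zero (/ 2) ltac:(rewrite Rabs_pos_eq; lra) _ hp) as [n0 hn0].
  exists n0; intros n hn; specialize (hn0 n hn).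
  assert (hh : 0 < (/ 2) ^ n) by (apply pow_lt; lra).
  rewrite Rabs_pos_eq in hn0 by lra.
  apply Rmult_lt_compat_l with (r := B + 1) in hn0; [| lra].
  replace ((B + 1) * (eps / (B + 1))) with eps in hn0 by (field; lra); lra.
Qed.

(** The Cauchy estimate passes to the limit. It covers every real [r], the iterates being 0 at
    negative radii, so that convergence is uniform on a full neighbourhood of the origin. *)
Lemma picard_limit_error (n : nat) (r : R) :
  Rabs (picard_limit r - picard n r) <= 2 * C * (/ 2) ^ n * exp (rate * r).
Proof.
  assert (hC := C_ge0); assert (he := exp_pos (rate * r)).
  assert (hc : forall n j, Rabs (picard (n + j) r - picard n r) <= 2 * C * (/ 2) ^ n * exp (rate * r)).
  { intros m j; destruct (Rle_dec 0 r) as [h | h]; [now apply picard_cauchy |].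
    rewrite !picard_nonpos, Rminus_diag, Rabs_R0 by lra.
    assert (0 < (/ 2) ^ m) by (apply pow_lt; lra).
    repeat apply Rmult_le_pos; lra. }
  assert (hlim : is_lim_seq (fun n => picard n r) (picard_limit r)).
  { apply Lim_seq_correct', ex_lim_seq_cauchy_corr; intros eps.
    destruct (half_pow_small (4 * C * exp (rate * r)) eps) as [n0 hn0];
      [repeat apply Rmult_le_pos; lra | apply cond_pos |].
    exists n0; intros i j hi hj.
    assert (h1 := hc n0 (i - n0)%nat); assert (h2 := hc n0 (j - n0)%nat).
    replace (n0 + (i - n0))%nat with i in h1 by lia.
    replace (n0 + (j - n0))%nat with j in h2 by lia.
    specialize (hn0 n0 (Nat.le_refl _)).
    apply Rabs_le_between in h1; apply Rabs_le_between in h2; apply Rabs_def1; lra. }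
  assert (hlim' : is_lim_seq (fun j => Rabs (picard (j + n) r - picard n r)) (Rabs (picard_limit r - picard n r))).
  { apply (is_lim_seq_abs _ (picard_limit r - picard n r)).
    apply is_lim_seq_minus'; [| apply is_lim_seq_const].
    now apply (is_lim_seq_incr_n (fun n => picard n r)). }
  apply (is_lim_seq_le (fun j => Rabs (picard (j + n) r - picard n r))
    (fun _ => 2 * C * (/ 2) ^ n * exp (rate * r)) (Rabs (picard_limit r - picard n r))
    (2 * C * (/ 2) ^ n * exp (rate * r))); [| exact hlim' |].
  { intros j; rewrite Nat.add_comm; apply hc. }
  apply is_lim_seq_const.
Qed.

Lemma continuous_picard_limit (r : R) : continuous picard_limit r.
Proof.
  apply continuity_pt_filterlim.
  apply (CVU_continuity picard picard_limit r (mkposreal 1 Rlt_0_1)).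
  - intros eps heps; assert (hC := C_ge0); assert (he := exp_pos (rate * (r + 1))).
    destruct (half_pow_small (2 * C * exp (rate * (r + 1))) eps) as [n0 hn0];
      [repeat apply Rmult_le_pos; lra | exact heps |].
    exists n0; intros n y hn hy.
    apply Rle_lt_trans with (1 := picard_limit_error n y).
    apply Rle_lt_trans with (2 := hn0 n hn).
    assert (exp (rate * y) <= exp (rate * (r + 1))).
    { unfold Boule in hy; simpl in hy; apply Rabs_def2 in hy.
      left; apply exp_increasing; assert (hL := L_ge0); unfold rate; nra. }
    assert (0 < (/ 2) ^ n) by (apply pow_lt; lra).
    assert (0 <= 2 * C * (/ 2) ^ n) by (repeat apply Rmult_le_pos; lra).
    replace (2 * C * exp (rate * (r + 1)) * (/ 2) ^ n) with (2 * C * (/ 2) ^ n * exp (rate * (r + 1))) by ring.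
    now apply Rmult_le_compat_l.
  - intros n y _; apply continuity_pt_filterlim, continuous_picard.
  - unfold Boule; simpl; rewrite Rminus_diag, Rabs_R0; lra.
Qed.

(** Both sides are within a multiple of [2^(-n)] of iterate [n + 1]: the left by the error estimate,
    the right by contraction from iterate [n]. *)
Lemma picard_limit_fixed (r : R) : 0 <= r -> picard_limit r = picard_step picard_limit r.
Proof.
  intros hr; assert (hC := C_ge0); assert (he := exp_pos (rate * r)).
  apply Rminus_diag_uniq, Rabs_eq_0, Rle_antisym; [| apply Rabs_pos].
  apply le_epsilon; intros eps heps; rewrite Rplus_0_l.
  destruct (half_pow_small (2 * C * exp (rate * r)) eps) as [n hn];
    [repeat apply Rmult_le_pos; lra | exact heps |].
  specialize (hn n (Nat.le_refl _)).
  assert (h1 := picard_limit_error (S n) r).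
  assert (h2 := picard_step_contraction picard_limit (picard n) (2 * C * (/ 2) ^ n)
    continuous_picard_limit (continuous_picard n) (fun s _ => picard_limit_error n s) r hr).
  change (picard_step (picard n) r) with (picard (S n) r) in h2.
  rewrite Rabs_minus_sym in h2.
  replace (picard_limit r - picard_step picard_limit r)
    with ((picard_limit r - picard (S n) r) + (picard (S n) r - picard_step picard_limit r)) by ring.
  apply Rle_trans with (1 := Rabs_triang _ _); simpl pow in h1; lra.
Qed.

Lemma singular_ivp : exists v,
  (forall r, continuous v r) /\ v 0 = 0 /\ forall r, 0 <= r -> flux v r = r ^ k * v r.
Proof.
  assert (h0 : picard_limit 0 = 0) by (rewrite picard_limit_fixed, picard_step_nonpos; lra).
  exists picard_limit; split; [apply continuous_picard_limit | split; [exact h0 |]].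
  intros r [hr | <-].
  - rewrite (picard_limit_fixed r) by lra; rewrite picard_step_pos by exact hr.
    assert (hrk : 0 < r ^ k) by (apply pow_lt; lra); field; lra.
  - unfold flux; rewrite RInt_0_0, h0; ring.
Qed.

End Picard.

(** * Existence *)

Lemma Rmin_lipschitz (c x y : R) : Rabs (Rmin c x - Rmin c y) <= Rabs (x - y).
Proof. unfold Rmin; destruct (Rle_dec c x), (Rle_dec c y); unfold Rabs; repeat destruct Rcase_abs; lra. Qed.

Lemma rpow_truncated_lipschitz (a c x y : R) : 1 < a ->
  Rabs (rpow (Rmin c x) a - rpow (Rmin c y) a) <= a * rpow c (a - 1) * Rabs (x - y).
Proof.
  intros ha.
  apply Rle_trans with (a * rpow c (a - 1) * Rabs (Rmin c x - Rmin c y)).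
  - assert (h1 := Rmin_l c x); assert (h2 := Rmin_l c y).
    destruct (Rle_dec (Rmin c x) (Rmin c y)) as [h | h].
    + destruct (rpow_lipschitz a c (Rmin c x) (Rmin c y) ha (conj h h2)) as [h3 h4].
      rewrite (Rabs_minus_sym (rpow (Rmin c x) a)), (Rabs_minus_sym (Rmin c x)), !Rabs_pos_eq; lra.
    + destruct (rpow_lipschitz a c (Rmin c y) (Rmin c x) ha ltac:(lra)) as [h3 h4].
      rewrite !Rabs_pos_eq; lra.
  - apply Rmult_le_compat_l; [| apply Rmin_lipschitz].
    apply Rmult_le_pos; [lra | apply rpow_ge0].
Qed.

Section Existence.

Variables (N : nat) (p M : R).
Hypotheses (N_ge3 : (3 <= N)%nat) (hp : (INR N + 2) / (INR N - 2) <= p) (M_lt0 : M < 0).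

Let q := 2 * p / (p + 1).
Let k := (N - 1)%nat.

Definition slope_cap : R := rpow (/ - M) (/ (2 * p / (p + 1))).

(* The truncations at [u = 1] and at the slope [slope_cap], where [|M| v^q = 1], are never reached, because the
   latter is a barrier for [v = - u'] as long as [u <= 1]. *)
Definition truncated_source (u v : R) : R :=
  rpow (Rmin 1 u) p + M * rpow (Rmin slope_cap v) (2 * p / (p + 1)).

Lemma rpow_slope_cap : 0 < slope_cap /\ - M * rpow slope_cap q = 1.
Proof.
  assert (hq1 : 1 < q) by (apply (q_gt1 N); assumption).
  assert (hM : 0 < / - M) by (apply Rinv_0_lt_compat; lra).
  assert (hc : 0 < slope_cap) by now apply rpow_gt0.
  split; [exact hc |].
  rewrite (rpow_pos slope_cap) by exact hc; unfold slope_cap; rewrite rpow_pos by exact hM; fold q.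
  rewrite Rpower_mult, Rinv_l, Rpower_1 by lra; field; lra.
Qed.

(** The two terms lie in [[0, 1]] and [[-1, 0]], the second by the choice of [slope_cap]. *)
Lemma truncated_source_bounded (u v : R) : Rabs (truncated_source u v) <= 1.
Proof.
  assert (hq1 : 1 < q) by (apply (q_gt1 N); assumption).
  assert (hp1 := p_gt1 N p N_ge3 hp).
  destruct rpow_slope_cap as [hc hcq].
  assert (h1 : rpow (Rmin 1 u) p <= rpow 1 p) by (apply rpow_le; [lra | apply Rmin_l]).
  rewrite rpow_1_l in h1.
  assert (h2 : rpow (Rmin slope_cap v) q <= rpow slope_cap q) by (apply rpow_le; [lra | apply Rmin_l]).
  assert (h3 := rpow_ge0 (Rmin 1 u) p); assert (h4 := rpow_ge0 (Rmin slope_cap v) q).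
  unfold truncated_source; fold q; apply Rabs_le; split; nra.
Qed.

Lemma truncated_source_lipschitz : exists L, forall u v u' v',
  Rabs (truncated_source u v - truncated_source u' v') <= L * (Rabs (u - u') + Rabs (v - v')).
Proof.
  assert (hq1 : 1 < q) by (apply (q_gt1 N); assumption).
  assert (hp1 := p_gt1 N p N_ge3 hp).
  exists (p * rpow 1 (p - 1) + - M * (q * rpow slope_cap (q - 1))); intros u v u' v'.
  assert (h1 := rpow_truncated_lipschitz p 1 u u' hp1).
  assert (h2 := rpow_truncated_lipschitz q slope_cap v v' hq1).
  assert (h3 := rpow_ge0 1 (p - 1)); assert (h4 := rpow_ge0 slope_cap (q - 1)).
  assert (h5 := Rabs_pos (u - u')); assert (h6 := Rabs_pos (v - v')).
  unfold truncated_source; fold q.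
  replace (rpow (Rmin 1 u) p + M * rpow (Rmin slope_cap v) q
    - (rpow (Rmin 1 u') p + M * rpow (Rmin slope_cap v') q))
    with ((rpow (Rmin 1 u) p - rpow (Rmin 1 u') p)
      + M * (rpow (Rmin slope_cap v) q - rpow (Rmin slope_cap v') q)) by ring.
  apply Rle_trans with (1 := Rabs_triang _ _).
  rewrite Rabs_mult, (Rabs_left M) by exact M_lt0.
  apply Rmult_le_compat_l with (r := - M) in h2; [| lra].
  assert (0 <= p * rpow 1 (p - 1)) by (apply Rmult_le_pos; lra).
  assert (0 <= - M * (q * rpow slope_cap (q - 1))) by (apply Rmult_le_pos; [lra | apply Rmult_le_pos; lra]).
  assert (0 <= p * rpow 1 (p - 1) * Rabs (v - v')) by (apply Rmult_le_pos; lra).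
  assert (0 <= - M * (q * rpow slope_cap (q - 1)) * Rabs (u - u')) by (apply Rmult_le_pos; lra).
  lra.
Qed.

(** * The solution of the truncated problem solves the original one *)

Section TruncatedSolution.

Variable v : R -> R.
Hypotheses (v_cont : forall r, continuous v r) (v_0 : v 0 = 0)
  (v_flux : forall r, 0 <= r -> flux truncated_source k v r = r ^ k * v r).

Let g := source truncated_source v.
Let u := height v.

Lemma is_derive_truncated_flux (r : R) : is_derive (flux truncated_source k v) r (r ^ k * g r).
Proof. destruct truncated_source_lipschitz as [L hL]; now apply (is_derive_flux _ _ L). Qed.

Lemma continuous_truncated_source (r : R) : continuous g r.
Proof. destruct truncated_source_lipschitz as [L hL]; now apply (continuous_source _ L). Qed.

(** Beyond the last zero before a negative value, [v <= 0] removes the gradient term; the source is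
    then nonnegative and [r^k v] cannot decrease. *)
Lemma slope_nonneg (r : R) : 0 <= r -> 0 <= v r.
Proof.
  intros hr; apply Rnot_lt_le; intros hlt.
  destruct (last_crossing (fun r => - v r) 0 r 0) as [s [hs [hs0 hsr]]]; [exact hr | | rewrite v_0; lra |].
  { intros x _; apply (continuous_opp v), v_cont. }
  assert (h : flux truncated_source k v s <= flux truncated_source k v r).
  { apply (nondecreasing_of_derive _ (fun r => r ^ k * g r)); [lra | intros; apply is_derive_truncated_flux |].
    intros x hx; apply Rmult_le_pos; [apply pow_le; lra |].
    assert (hvx : v x <= 0).
    { destruct (Req_dec x s) as [-> | hne]; [lra |]; specialize (hsr x ltac:(lra)); lra. }
    unfold g, source, truncated_source.
    rewrite (rpow_nonpos (Rmin slope_cap (v x))) by (apply Rle_trans with (1 := Rmin_r _ _); exact hvx).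
    assert (h := rpow_ge0 (Rmin 1 (height v x)) p); lra. }
  rewrite !v_flux in h by lra.
  assert (0 < r ^ k) by (apply pow_lt; lra).
  replace (v s) with 0 in h by lra; nra.
Qed.

(** Above the cap the truncated gradient term is exactly [-1] and outweighs the truncated power of
    [u]; then [r^k v] is nonincreasing and [v] cannot rise above the cap. *)
Lemma slope_le_cap (r : R) : 0 <= r -> v r <= slope_cap.
Proof.
  intros hr; apply Rnot_lt_le; intros hlt.
  destruct rpow_slope_cap as [hc hcq].
  assert (hp1 := p_gt1 N p N_ge3 hp).
  destruct (last_crossing v 0 r slope_cap) as [s [hs [hs0 hsr]]];
    [exact hr | intros; apply v_cont | rewrite v_0; lra |].
  assert (h : flux truncated_source k v r <= flux truncated_source k v s).
  { apply (nonincreasing_of_derive _ (fun r => r ^ k * g r)); [lra | intros; apply is_derive_truncated_flux |].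
    intros x hx.
    assert (hvx : slope_cap <= v x).
    { destruct (Req_dec x s) as [-> | hne]; [lra |]; specialize (hsr x ltac:(lra)); lra. }
    assert (hS : g x <= 0).
    { unfold g, source, truncated_source; rewrite (Rmin_left slope_cap) by exact hvx; fold q.
      assert (h1 : rpow (Rmin 1 (height v x)) p <= rpow 1 p) by (apply rpow_le; [lra | apply Rmin_l]).
      rewrite rpow_1_l in h1; lra. }
    assert (0 <= x ^ k) by (apply pow_le; lra); nra. }
  rewrite !v_flux in h by lra.
  assert (0 < r ^ k) by (apply pow_lt; lra).
  assert (s ^ k <= r ^ k) by (apply pow_incr; lra).
  rewrite hs0 in h.
  assert (s ^ k * slope_cap <= r ^ k * slope_cap) by (apply Rmult_le_compat_r; lra); nra.
Qed.

Lemma height_0 : u 0 = 1.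
Proof. unfold u, height; rewrite RInt_0_0; ring. Qed.

Lemma height_derive (r : R) : is_derive u r (- v r).
Proof. now apply is_derive_height. Qed.

Lemma height_nonincreasing (r s : R) : 0 <= r <= s -> u s <= u r.
Proof.
  intros h; apply (nonincreasing_of_derive u (fun r => - v r)); [lra | intros; apply height_derive |].
  intros x hx; assert (h' := slope_nonneg x ltac:(lra)); lra.
Qed.

(** At the origin [v / r] tends to [g 0 / N], hence so does [g - (N - 1) / r * v]; this fixes the
    value there. *)
Definition second_derivative (r : R) : R :=
  if Rle_dec r 0 then - (source truncated_source v 0 / INR N)
  else - (source truncated_source v r - (INR N - 1) / r * v r).

Lemma second_derivative_pos (r : R) : 0 < r -> second_derivative r = - (g r - (INR N - 1) / r * v r).
Proof. intros h; unfold second_derivative; destruct (Rle_dec r 0); [lra | reflexivity]. Qed.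

Lemma second_derivative_0 : second_derivative 0 = - (g 0 / INR N).
Proof. unfold second_derivative; destruct (Rle_dec 0 0); [reflexivity | lra]. Qed.

Lemma slope_derive (r : R) : 0 < r -> is_derive (fun r => - v r) r (second_derivative r).
Proof.
  intros hr; rewrite second_derivative_pos by exact hr.
  apply @is_derive_opp.
  apply is_derive_ext_loc with (fun r => flux truncated_source k v r / r ^ k).
  - exists (mkposreal r hr); intros y hy; apply Rabs_lt_between' in hy; simpl in hy.
    rewrite v_flux by lra; assert (0 < y ^ k) by (apply pow_lt; lra).
    change (@eq R (y ^ k * v y / y ^ k) (v y)); field; lra.
  - assert (hf := is_derive_truncated_flux r).
    assert (hrk : 0 < r ^ k) by (apply pow_lt; lra).
    assert (hpow : is_derive (fun r => r ^ k) r (INR k * (r ^ k / r))).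
    { replace (r ^ k / r) with (r ^ Init.Nat.pred k).
      - apply is_derive_Reals, derivable_pt_lim_pow.
      - replace (r ^ k) with (r ^ (S (Init.Nat.pred k))) by (f_equal; unfold k; lia).
        simpl; field; lra. }
    assert (hd := is_derive_div _ _ _ _ _ hf hpow ltac:(lra)).
    simpl in hd; rewrite v_flux in hd by lra.
    assert (hk : INR k = INR N - 1) by (unfold k; rewrite minus_INR by lia; simpl; ring).
    replace (g r - (INR N - 1) / r * v r)
      with ((r ^ k * g r * r ^ k - r ^ k * v r * (INR k * (r ^ k / r))) / (r ^ k * (r ^ k * 1))).
    + exact hd.
    + rewrite hk; field; lra.
Qed.

(** By the integral equation [v h / h] is the flux divided by [h^(k+1)], to which
    [weighted_mean_limit] applies with [k + 1 = N]. *)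
Lemma slope_quotient :
  filterlim (fun h => v h / h) (at_right 0) (locally (g 0 / INR N)).
Proof.
  apply filterlim_locally; intros eps.
  destruct (weighted_mean_limit g k eps continuous_truncated_source (cond_pos eps)) as [del [hd hdel]].
  exists (mkposreal del hd); intros h hh hpos.
  apply Rabs_lt_between' in hh; simpl in hh.
  specialize (hdel h ltac:(lra)).
  replace (INR (S k)) with (INR N) in hdel by (f_equal; unfold k; lia).
  change (RInt (fun s => s ^ k * g s) 0 h) with (flux truncated_source k v h) in hdel.
  rewrite v_flux in hdel by lra.
  assert (0 < h ^ k) by (apply pow_lt; lra).
  replace (h ^ k * v h / h ^ k / h) with (v h / h) in hdel by (field; lra).
  exact hdel.
Qed.

Lemma height_C2 : C2_nonneg u (fun r => - v r) second_derivative.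
Proof.
  assert (hN := INR_N_ge3 N N_ge3).
  split; [intros; apply height_derive | split; [exact slope_derive | split; [| split; [| split]]]].
  - intros r hr.
    apply continuous_ext_loc with (fun r => - (g r - (INR N - 1) / r * v r)).
    + exists (mkposreal r hr); intros y hy; apply Rabs_lt_between' in hy; simpl in hy.
      symmetry; apply second_derivative_pos; lra.
    + apply @continuous_opp, @continuous_minus; [apply continuous_truncated_source |].
      apply (continuous_mult (fun r => (INR N - 1) / r) v); [| apply v_cont].
      apply (ex_derive_continuous (fun r => (INR N - 1) / r)); auto_derive; lra.
  - apply right_quotient_of_derive, height_derive.
  - apply filterlim_ext with (fun h => - (v h / h)).
    + intros h; rewrite v_0; unfold Rdiv; ring.
    + rewrite second_derivative_0.
      apply (filterlim_comp _ _ _ (fun h => v h / h) Ropp _ (locally (g 0 / INR N))); [exact slope_quotient |].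
      apply (@filterlim_opp R_AbsRing R_NormedModule).
  - apply filterlim_within_ext with (fun r => - g r + (INR N - 1) * (v r / r)).
    + intros r hr; rewrite second_derivative_pos by exact hr; field; lra.
    + rewrite second_derivative_0.
      replace (- (g 0 / INR N)) with (- g 0 + (INR N - 1) * (g 0 / INR N)) by (field; lra).
      apply (filterlim_Rplus (at_right 0)).
      * eapply filterlim_filter_le_1; [apply filter_le_within |].
        apply (continuous_opp g), continuous_truncated_source.
      * apply (filterlim_Rmult (at_right 0)); [apply filterlim_const | exact slope_quotient].
Qed.

(** Both truncations are inactive, by [slope_le_cap] and [u <= 1]. The sign of [u] is assumed only
    at this radius, so the equation is available before nonnegativity is known everywhere. *)
Lemma truncated_eqE (r : R) : 0 < r -> 0 <= u r -> eqE N p M u (fun r => - v r) second_derivative r.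
Proof.
  intros hr hur; unfold eqE.
  assert (hv := slope_nonneg r (Rlt_le _ _ hr)); assert (hvc := slope_le_cap r (Rlt_le _ _ hr)).
  assert (hu1 : u r <= 1) by (rewrite <- height_0; apply height_nonincreasing; lra).
  rewrite second_derivative_pos, Rabs_Ropp, !Rabs_pos_eq by assumption.
  rewrite <- rpow_succ by exact hur.
  replace (p - 1 + 1) with p by ring.
  unfold g, source, truncated_source; rewrite !Rmin_right by assumption.
  fold u; field; lra.
Qed.

Lemma height_right_limit : filterlim u (at_right 0) (locally 1).
Proof.
  rewrite <- height_0; eapply filterlim_filter_le_1; [apply filter_le_within |].
  apply (ex_derive_continuous u); eexists; apply height_derive.
Qed.

(** At a zero the potential vanishes and the energy is purely kinetic, hence nonnegative; then [u]
    would vanish all the way to the origin, against [u 0 = 1]. *)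
Lemma height_nonneg (r : R) : 0 <= r -> 0 <= u r.
Proof.
  intros hr; apply Rnot_lt_le; intros hlt.
  assert (hu0 := height_0).
  destruct (IVT_gen u 0 r 0) as [r1 [hr1 hz]].
  { intros x; apply continuity_pt_filterlim, (ex_derive_continuous u); eexists; apply height_derive. }
  { rewrite Rmin_right, Rmax_left; lra. }
  rewrite Rmin_left, Rmax_right in hr1 by exact hr.
  assert (hr1' : 0 < r1).
  { destruct (Req_dec r1 0) as [-> | hne]; lra. }
  (* Monotonicity gives the sign before the zero, whichever zero it is. *)
  assert (hnn : forall s, 0 < s <= r1 -> 0 <= u s).
  { intros s hs; rewrite <- hz; apply height_nonincreasing; lra. }
  assert (hzero : forall s, 0 < s < r1 -> u s = 0).
  { intros s hs.
    apply (profile_energy_nonneg N p M N_ge3 hp M_lt0 u (fun r => - v r) second_derivative 1 (ln r1)).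
    - rewrite exp_ln by exact hr1'; intros x hx.
      split; [apply height_derive | split; [apply slope_derive; lra | split; [now apply hnn | split]]].
      + assert (h := slope_nonneg x ltac:(lra)); lra.
      + apply truncated_eqE; [lra | now apply hnn].
    - exact height_right_limit.
    - replace (locally 0) with (locally (- v 0)) by (rewrite v_0; f_equal; ring).
      eapply filterlim_filter_le_1; [apply filter_le_within |].
      apply (continuous_opp v), v_cont.
    - unfold energy, potential, scaled_u; rewrite exp_ln, hz, Rmult_0_r, !(rpow_nonpos 0) by lra.
      assert (hp1 := p_gt1 N p N_ge3 hp).
      assert (h := pow2_ge_0 (2 / (p - 1) * 0 - scaled_slope p (fun r => - v r) (ln r1))).
      unfold Rdiv at 1 3 4 5; lra.
    - now rewrite exp_ln. }
  destruct (height_right_limit (ball 1 (mkposreal 1 Rlt_0_1)) (locally_ball _ _)) as [del hdel].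
  assert (hd := cond_pos del).
  set (s := Rmin (r1 / 2) (del / 2)).
  assert (hs0 : 0 < s) by (apply Rmin_pos; lra).
  assert (hs1 : s <= r1 / 2) by apply Rmin_l.
  assert (hs2 : s <= del / 2) by apply Rmin_r.
  assert (h := hdel s ltac:(apply Rabs_lt_between'; lra) hs0).
  apply Rabs_lt_between' in h; simpl in h; rewrite hzero in h; lra.
Qed.

Lemma height_ground_state : ground_state N p M u.
Proof.
  exists (fun r => - v r), second_derivative.
  split; [exact height_C2 | split; [exact height_nonneg | split; [rewrite v_0; ring |]]].
  intros r hr; apply truncated_eqE; [exact hr | apply height_nonneg; lra].
Qed.

End TruncatedSolution.

Lemma ground_state_exists : exists u : R -> R, ground_state N p M u /\ exists r, 0 <= r /\ u r <> 0.
Proof.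
  destruct truncated_source_lipschitz as [L hL].
  destruct (singular_ivp truncated_source k L 1 hL truncated_source_bounded) as [v [hv [hv0 hvf]]].
  exists (height v); split; [now apply height_ground_state |].
  exists 0; split; [lra |]; rewrite height_0; lra.
Qed.

End Existence.

Theorem theorem4p11 (N : nat) (p M : R) :
  M < 0 -> (3 <= N)%nat -> (INR N + 2) / (INR N - 2) <= p ->
  (exists u : R -> R, ground_state N p M u /\ exists r, 0 <= r /\ u r <> 0) /\
  (forall u : R -> R, ground_state N p M u -> (exists r, 0 <= r /\ u r <> 0) ->
     forall X : R, is_XM N p M X ->
       is_lim (fun r => u r / U_M p X r) p_infty 1).
Proof.
  intros hM hN hp; split.
  - now apply ground_state_exists.
  - intros u hu hnt X hX; now apply (ground_state_asymptotics N p M hN hp hM u hu hnt).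
Qed.
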